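(* Suppose the following hold. (1) $V_0\subseteq V_1$ are models of set theory. (2) $\mathcal{W}\in V_0$ is (in $V_0$) a continuous distance monoid with $(\mathrm{coinit}(\mathcal{W}))^{V_0}>\omega$. (3) In $V_1$, the ordinal $\mathrm{coinit}(\mathcal{W})^{V_0}$ has cofinality $\omega$. Then there is a $\mathcal{W}$-dynamical system in $V_0$ which has no fixed point but whose relativization to $V_1$ for being a generalized dynamical system does have a fixed point.
   Context: **Models of set theory.** We work in a background model of ZFC; a *model of set theory* is a transitive subclass $V$ of it with $(V,\in)\models \mathrm{ZFC}$. **Distance monoids.** A *distance monoid* (commutative positive linear ordered monoid) is $\mathcal{W}=\langle W,+,0,\leq\rangle$ where $\langle W,+,0\rangle$ is a commutative monoid, $\leq$ is a linear order with minimal element $0$, $a\leq b$ implies $c+a\leq c+b$ and $a+c\leq b+c$, and $b+\bigwedge A=\bigwedge_{a\in A}(a+b)$ for all $b\in W$ and $A\subseteq W$ (whose infimum exists). Write $W^+=W\setminus\{0\}$. $\mathcal{W}$ is *continuous at $0$* if $0=\bigwedge_{a,b\in W^+}(a+b)$; *complete* if $\langle W,\leq\rangle$ is a complete linear order; *continuous* if complete and continuous at $0$. The *completion* $\overline{\mathcal{W}}$ of $\mathcal{W}$ is the distance monoid whose order is the Dedekind–MacNeille completion of $\langle W,\leq\rangle$ and whose addition extends that of $\mathcal W$; explicitly $a+b=\bigwedge\{a'+b' : a',b'\in W,\ a'\geq a,\ b'\geq b\}$. **Coinitiality.** An *initial sequence* in $\mathcal{W}$ is an order preserving map $s:(\alpha^{op},\leq)\to(W^+,\leq)$,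 $\alpha$ an ordinal (so $i\leq j$ implies $s(j)\leq s(i)$), such that for every $a\in W^+$ there is $\beta\in\alpha$ with $s(\beta)\leq a$. $\mathrm{coinit}(\mathcal{W})$ is the smallest ordinal that is the domain of an initial sequence. **$\mathcal{W}$-metric spaces.** A *$\mathcal{W}$-metric space* is $\mathcal{M}=(M,d)$ with $d:M\times M\to W$ (not assumed symmetric) such that $\max(d(x,y),d(y,x))=0$ iff $x=y$, and $d(x,z)\leq d(x,y)+d(y,z)$. A map $f$ is *non-expanding* if $d(f(x),f(y))\leq d(x,y)$ for all $x,y$. **Cauchy completeness.** A *Cauchy sequence* on $\mathcal{M}$ is a map $p:A\to M$, $A\subseteq W^+$ with $\bigwedge_{a,b\in A}(a+b)=0$, such that $d(p(a),p(b))\leq a+b$ for all $a,b\in A$; $\mathrm{dom}(p)=A$. It *converges* to $x\in M$ if $\bigvee_{a\in W^+}\bigwedge_{b\leq a,\,b\in \mathrm{dom}(p)}d(x,p(b))=0$ and $\bigvee_{a\in W^+}\bigwedge_{b\leq a,\,b\in \mathrm{dom}(p)}d(p(b),x)=0$. $(\mathcal{M},\mathcal{W})$ is *Cauchy complete* if $\mathcal{W}$ is complete and every Cauchy sequence on $\mathcal M$ converges to an element of $M$. (If $\mathcal{W}$ is not continuous at $0$ there are no Cauchy sequences.) **Cauchy completion.** If $\mathcal{W}$ is continuous, for Cauchy sequences $p,q$ put $d(p,q)=\bigvee_{c\in W^+}\bigwedge\{d(p(a),q(b)) : a\in \mathrm{dom}(p), b\in\mathrm{dom}(q), a,b\leq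 c\}$, and $p\equiv q$ iff $d(p,q)=d(q,p)=0$. The Cauchy completion $\mathbf{cc}(\mathcal{M})$ is the space of $\equiv$-classes with the induced distance, where each $x\in M$ is identified with the class of the constant sequence $\widehat{x}:W^+\to M$ with value $x$, so that $M\subseteq \mathbf{cc}(M)$. If $\mathcal{W}$ is not continuous at $0$, $\mathbf{cc}(\mathcal{M})$ is $\mathcal{M}$ regarded as a $\overline{\mathcal{W}}$-metric space. In general the Cauchy completion of $(\mathcal{M},\mathcal{W})$ is $(\mathbf{cc}(\mathcal{M}),\overline{\mathcal{W}})$, where for $\mathcal{W}$ continuous at $0$ one first regards $\mathcal M$ as a $\overline{\mathcal{W}}$-metric space. A non-expanding $f:\mathcal{M}\to\mathcal{M}$ has a unique non-expanding extension $\mathbf{cc}(f):\mathbf{cc}(\mathcal{M})\to\mathbf{cc}(\mathcal{M})$. **Dynamical systems.** For $\mathcal{W}$ a complete distance monoid, a *$\mathcal{W}$-dynamical system* is $(\mathcal{M},f)$ with $\mathcal{M}$ a Cauchy complete $\mathcal{W}$-metric space and $f:\mathcal{M}\to\mathcal{M}$ non-expanding; then $(\mathcal{M},f,\mathcal{W})$ is a *generalized dynamical system*. It *has a fixed point* if $f(x)=x$ for some $x\in M$. **Relativization.** For models of set theory $V_0\subseteq V_1$ and a generalized dynamical system $(\mathcal{M},f,\mathcal{W})\in V_0$ (in the sense of $V_0$), its *relativization to $V_1$ for being a generalized dynamical system* is $(\mathbf{cc}(\mathcal{M}),\mathbf{cc}(f),\overline{\mathcal{W}})^{V_1}$, i.e.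 these completions computed in $V_1$. *)

(* Defs.v *)
From Stdlib Require Import Classical ClassicalEpsilon.

Set Implicit Arguments.
Unset Strict Implicit.

Declare Scope mset_scope.
Open Scope mset_scope.

Record membership := Membership {
  mcarrier :> Type;
  mem : mcarrier -> mcarrier -> Prop }.

Arguments mem {m}.
Notation "x ∈ y" := (mem x y) (at level 70, no associativity) : mset_scope.

(* Formulas of the language of set theory with de Bruijn indices: [FAll] binds
   the index 0.  They are needed because Separation and Replacement must be the
   first-order schemas; the second-order versions would make every inclusion of
   transitive models essentially rigid. *)
Inductive formula : Type :=
| FMem (i j : nat)
| FEq (i j : nat)
| FBot
| FImp (p q : formula)
| FAll (p : formula).

Definition scons {T : Type} (x : T) (e : nat -> T) (n : nat) : T :=
  match n with O => x | S k => e k end.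

Fixpoint sat (X : membership) (e : nat -> X) (p : formula) : Prop :=
  match p with
  | FMem i j => e i ∈ e j
  | FEq i j => e i = e j
  | FBot => False
  | FImp p q => sat e p -> sat e q
  | FAll p => forall x : X, sat (scons x e) p
  end.

Section SetTheory.
Context (X : membership).

Definition extensionality_axiom : Prop :=
  forall a b : X, (forall x, x ∈ a <-> x ∈ b) -> a = b.

Definition foundation_axiom : Prop :=
  forall a : X, (exists x, x ∈ a) ->
  exists x, x ∈ a /\ forall y, y ∈ x -> ~ y ∈ a.

Definition pairing_axiom : Prop :=
  forall a b : X, exists c, forall x, x ∈ c <-> x = a \/ x = b.

Definition union_axiom : Prop :=
  forall a : X, exists u, forall x, x ∈ u <-> exists y, y ∈ a /\ x ∈ y.

Definition powerset_axiom : Prop :=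
  forall a : X, exists b, forall x, x ∈ b <-> (forall y, y ∈ x -> y ∈ a).

Definition infinity_axiom : Prop :=
  exists a : X,
    (exists z, z ∈ a /\ forall x, ~ x ∈ z) /\
    (forall x, x ∈ a ->
       exists y, y ∈ a /\ forall z, z ∈ y <-> z ∈ x \/ z = x).

Definition separation_schema : Prop :=
  forall (p : formula) (e : nat -> X) (a : X),
  exists b, forall x, x ∈ b <-> x ∈ a /\ sat (scons x e) p.

(* In [p], index 0 is the value, index 1 the argument, and the remaining
   indices are parameters. *)
Definition replacement_schema : Prop :=
  forall (p : formula) (e : nat -> X) (a : X),
  (forall x, x ∈ a -> exists! y, sat (scons y (scons x e)) p) ->
  exists b, forall y,
    y ∈ b <-> exists x, x ∈ a /\ sat (scons y (scons x e)) p.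

Definition choice_axiom : Prop :=
  forall a : X,
  (forall x, x ∈ a -> exists z, z ∈ x) ->
  (forall x y z, x ∈ a -> y ∈ a -> z ∈ x -> z ∈ y -> x = y) ->
  exists c, forall x, x ∈ a -> exists! z, z ∈ x /\ z ∈ c.

Definition ZFC : Prop :=
  extensionality_axiom /\ foundation_axiom /\ pairing_axiom /\ union_axiom /\
  powerset_axiom /\ infinity_axiom /\ separation_schema /\
  replacement_schema /\ choice_axiom.

End SetTheory.

Definition subclass (U : membership) (V : U -> Prop) : membership :=
  @Membership {x : U | V x} (fun x y => proj1_sig x ∈ proj1_sig y).

Definition model_of_set_theory (U : membership) (V : U -> Prop) : Prop :=
  (forall x y : U, V y -> x ∈ y -> V x) /\ ZFC (subclass V).

Definition incl (U : membership) (V0 V1 : U -> Prop)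
    (H : forall x, V0 x -> V1 x) (x : subclass V0) : subclass V1 :=
  exist _ (proj1_sig x) (H _ (proj2_sig x)).

(* Everything below is relative to a structure [X]: quantifiers over sets range
   over [X], and functions, relations, subsets and sequences are elements
   of [X].  Hence a notion instantiated at [subclass V] is that notion in the
   sense of [V]. *)

Record monoid_data (X : membership) := MonoidData {
  car : X; add : X; zero : X; le : X }.

Record space (X : membership) := Space { pts : X; dist : X }.

Definition map_monoid (X Y : membership) (h : X -> Y) (W : monoid_data X) :=
  MonoidData (h (car W)) (h (add W)) (h (zero W)) (h (le W)).

Definition map_space (X Y : membership) (h : X -> Y) (M : space X) :=
  Space (h (pts M)) (h (dist M)).

Section Internal.
Context {X : membership}.
Implicit Types (a b c f p q s t x y z A B : X) (P : X -> Prop).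
Implicit Types (W : monoid_data X) (M N : space X).

(* Definite description; the first argument only witnesses that [X] is
   inhabited. *)
Definition the (x0 : X) P : X := epsilon (inhabits x0) P.

Definition subset a b : Prop := forall x, x ∈ a -> x ∈ b.

Definition sep a P : X := the a (fun b => forall x, x ∈ b <-> x ∈ a /\ P x).

Definition power a : X := the a (fun b => forall x, x ∈ b <-> subset x a).

Definition upair a b : X := the a (fun c => forall x, x ∈ c <-> x = a \/ x = b).

Definition pair a b : X := upair (upair a a) (upair a b).

Definition prod a b : X :=
  the a (fun c => forall t,
    t ∈ c <-> exists x y, x ∈ a /\ y ∈ b /\ t = pair x y).

Definition is_func f a b : Prop :=
  (forall t, t ∈ f -> exists x y, x ∈ a /\ y ∈ b /\ t = pair x y) /\
  (forall x, x ∈ a -> exists! y, pair x y ∈ f).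

Definition in_dom f x : Prop := exists y, pair x y ∈ f.

Definition app f x : X := the x (fun y => pair x y ∈ f).

Definition app2 f x y : X := app f (pair x y).

Definition mkfun a b (F : X -> X) : X :=
  sep (prod a b) (fun t => exists x, x ∈ a /\ t = pair x (F x)).

Definition is_ordinal a : Prop :=
  (forall x y, x ∈ a -> y ∈ x -> y ∈ a) /\
  (forall x y z, x ∈ a -> y ∈ a -> z ∈ a -> x ∈ y -> y ∈ z -> x ∈ z) /\
  (forall x y, x ∈ a -> y ∈ a -> x ∈ y \/ x = y \/ y ∈ x) /\
  (forall b, subset b a -> (exists x, x ∈ b) ->
     exists x, x ∈ b /\ forall y, y ∈ b -> ~ y ∈ x).

Definition ord_le a b : Prop := a ∈ b \/ a = b.

Definition is_limit a : Prop :=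
  is_ordinal a /\ (exists x, x ∈ a) /\
  (forall x, x ∈ a -> exists y, y ∈ a /\ x ∈ y).

Definition is_omega a : Prop :=
  is_limit a /\ forall x, x ∈ a -> ~ is_limit x.

Definition cofinal_map f a b : Prop :=
  is_func f a b /\
  forall x, x ∈ b -> exists i, i ∈ a /\ ord_le x (app f i).

(* [is_cofinality b a] : the ordinal [b] has cofinality [a]. *)
Definition is_cofinality b a : Prop :=
  is_ordinal b /\ is_ordinal a /\ (exists f, cofinal_map f a b) /\
  forall c, c ∈ a -> ~ exists f, cofinal_map f c b.

Definition wadd W a b : X := app2 (add W) a b.
Definition wle W a b : Prop := pair a b ∈ le W.
Definition wpos W : X := sep (car W) (fun a => a <> zero W).
Definition wmax W a b : X :=
  if excluded_middle_informative (wle W a b) then b else a.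

Definition is_inf W P x : Prop :=
  x ∈ car W /\ (forall a, P a -> wle W x a) /\
  forall y, y ∈ car W -> (forall a, P a -> wle W y a) -> wle W y x.

Definition is_sup W P x : Prop :=
  x ∈ car W /\ (forall a, P a -> wle W a x) /\
  forall y, y ∈ car W -> (forall a, P a -> wle W a y) -> wle W x y.

Definition winf W P : X := the (zero W) (is_inf W P).
Definition wsup W P : X := the (zero W) (is_sup W P).

Definition is_commutative_monoid W : Prop :=
  is_func (add W) (prod (car W) (car W)) (car W) /\
  zero W ∈ car W /\
  (forall a b c, a ∈ car W -> b ∈ car W -> c ∈ car W ->
     wadd W a (wadd W b c) = wadd W (wadd W a b) c) /\
  (forall a b, a ∈ car W -> b ∈ car W -> wadd W a b = wadd W b a) /\
  (forall a, a ∈ car W -> wadd W (zero W) a = a).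

Definition is_linear_order W : Prop :=
  subset (le W) (prod (car W) (car W)) /\
  (forall a, a ∈ car W -> wle W a a) /\
  (forall a b, wle W a b -> wle W b a -> a = b) /\
  (forall a b c, wle W a b -> wle W b c -> wle W a c) /\
  (forall a b, a ∈ car W -> b ∈ car W -> wle W a b \/ wle W b a).

Definition is_distance_monoid W : Prop :=
  is_commutative_monoid W /\
  is_linear_order W /\
  (forall a, a ∈ car W -> wle W (zero W) a) /\
  (forall a b c, c ∈ car W -> wle W a b ->
     wle W (wadd W c a) (wadd W c b) /\ wle W (wadd W a c) (wadd W b c)) /\
  (forall b A x, b ∈ car W -> subset A (car W) ->
     is_inf W (fun a => a ∈ A) x ->
     is_inf W (fun y => exists a, a ∈ A /\ y = wadd W a b) (wadd W b x)).

Definition continuous_at_0 W : Prop :=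
  is_inf W (fun x => exists a b, a ∈ wpos W /\ b ∈ wpos W /\ x = wadd W a b)
    (zero W).

(* Completeness includes the empty set, so there is a greatest element, in
   agreement with the Dedekind-MacNeille completion below. *)
Definition complete W : Prop :=
  forall A, subset A (car W) ->
  (exists x, is_inf W (fun a => a ∈ A) x) /\
  (exists x, is_sup W (fun a => a ∈ A) x).

Definition continuous W : Prop := complete W /\ continuous_at_0 W.

Definition is_initial_sequence W s a : Prop :=
  is_ordinal a /\ is_func s a (wpos W) /\
  (forall i j, i ∈ a -> j ∈ a -> ord_le i j -> wle W (app s j) (app s i)) /\
  (forall x, x ∈ wpos W -> exists i, i ∈ a /\ wle W (app s i) x).

Definition is_coinit W a : Prop :=
  (exists s, is_initial_sequence W s a) /\
  forall b, b ∈ a -> ~ exists s, is_initial_sequence W s b.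

Definition upper_bound W A u : Prop :=
  u ∈ car W /\ forall a, a ∈ A -> wle W a u.

Definition is_cut W A : Prop :=
  subset A (car W) /\
  forall x, x ∈ car W -> (x ∈ A <-> forall u, upper_bound W A u -> wle W x u).

Definition cuts W : X := sep (power (car W)) (is_cut W).

(* The image of an element of [W] in the completion. *)
Definition down W a : X := sep (car W) (fun x => wle W x a).

(* Elements [u] of [W] above the cut [A] are its upper bounds, and infima of
   cuts are intersections, so this is the infimum of the cuts
   [down W (u + v)] for [u >= A] and [v >= B]. *)
Definition cut_add W A B : X :=
  sep (car W) (fun x => forall u v,
    upper_bound W A u -> upper_bound W B v -> wle W x (wadd W u v)).

Definition completion W : monoid_data X :=
  MonoidData
    (cuts W)
    (sep (prod (prod (cuts W) (cuts W)) (cuts W)) (fun t =>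
       exists A B, A ∈ cuts W /\ B ∈ cuts W /\
         t = pair (pair A B) (cut_add W A B)))
    (down W (zero W))
    (sep (prod (cuts W) (cuts W)) (fun t =>
       exists A B, A ∈ cuts W /\ B ∈ cuts W /\ t = pair A B /\ subset A B)).

Definition d M x y : X := app2 (dist M) x y.

Definition is_metric_space W M : Prop :=
  is_func (dist M) (prod (pts M) (pts M)) (car W) /\
  (forall x y, x ∈ pts M -> y ∈ pts M ->
     (wmax W (d M x y) (d M y x) = zero W <-> x = y)) /\
  (forall x y z, x ∈ pts M -> y ∈ pts M -> z ∈ pts M ->
     wle W (d M x z) (wadd W (d M x y) (d M y z))).

Definition non_expanding W M N f : Prop :=
  is_func f (pts M) (pts N) /\
  forall x y, x ∈ pts M -> y ∈ pts M ->
    wle W (d N (app f x) (app f y)) (d M x y).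

Definition is_cauchy W M p : Prop :=
  exists A, subset A (wpos W) /\ is_func p A (pts M) /\
    is_inf W (fun x => exists a b, a ∈ A /\ b ∈ A /\ x = wadd W a b) (zero W) /\
    (forall a b, a ∈ A -> b ∈ A ->
       wle W (d M (app p a) (app p b)) (wadd W a b)).

Definition converges W M p x : Prop :=
  wsup W (fun y => exists a, a ∈ wpos W /\
    y = winf W (fun z => exists b, in_dom p b /\ wle W b a /\
                         z = d M x (app p b))) = zero W /\
  wsup W (fun y => exists a, a ∈ wpos W /\
    y = winf W (fun z => exists b, in_dom p b /\ wle W b a /\
                         z = d M (app p b) x)) = zero W.

Definition cauchy_complete W M : Prop :=
  complete W /\
  forall p, is_cauchy W M p -> exists x, x ∈ pts M /\ converges W M p x.

Definition cauchy_sequences W M : X :=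
  sep (power (prod (car W) (pts M))) (is_cauchy W M).

Definition cauchy_dist W M p q : X :=
  wsup W (fun y => exists c, c ∈ wpos W /\
    y = winf W (fun z => exists a b, in_dom p a /\ in_dom q b /\
                         wle W a c /\ wle W b c /\
                         z = d M (app p a) (app q b))).

Definition cauchy_equiv W M p q : Prop :=
  cauchy_dist W M p q = zero W /\ cauchy_dist W M q p = zero W.

Definition cauchy_class W M p : X :=
  sep (cauchy_sequences W M) (cauchy_equiv W M p).

Definition cauchy_classes W M : X :=
  sep (power (cauchy_sequences W M)) (fun c =>
    exists p, p ∈ cauchy_sequences W M /\ c = cauchy_class W M p).

Definition cc_continuous W M : space X :=
  Space
    (cauchy_classes W M)
    (sep (prod (prod (cauchy_classes W M) (cauchy_classes W M)) (car W))
      (fun t => exists p q,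
         p ∈ cauchy_sequences W M /\ q ∈ cauchy_sequences W M /\
         t = pair (pair (cauchy_class W M p) (cauchy_class W M q))
                  (cauchy_dist W M p q))).

Definition constant_sequence W M x : X :=
  mkfun (wpos W) (pts M) (fun _ => x).

(* [M] regarded as a space over the completion of [W]. *)
Definition base_change W M : space X :=
  Space (pts M)
    (mkfun (prod (pts M) (pts M)) (cuts W) (fun t => down W (app (dist M) t))).

Definition cc W M : space X :=
  if excluded_middle_informative (continuous_at_0 W)
  then cc_continuous (completion W) (base_change W M)
  else base_change W M.

(* The identification of the points of [M] with points of [cc W M]. *)
Definition cc_embed W M x : X :=
  if excluded_middle_informative (continuous_at_0 W)
  then cauchy_class (completion W) (base_change W M)
         (constant_sequence (completion W) (base_change W M) x)
  else x.

(* [g] is the (unique) non-expanding extension of [f] to [cc W M]. *)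
Definition is_cc_map W M f g : Prop :=
  non_expanding (completion W) (cc W M) (cc W M) g /\
  forall x, x ∈ pts M -> app g (cc_embed W M x) = cc_embed W M (app f x).

Definition is_dynamical_system W M f : Prop :=
  is_distance_monoid W /\ complete W /\ is_metric_space W M /\
  cauchy_complete W M /\ non_expanding W M M f.

Definition has_fixed_point M f : Prop :=
  exists x, x ∈ pts M /\ app f x = x.

End Internal.

(* [(W1, M1, g)] is the relativization of [(W, M, f)], which lies in [V0],
   to [V1]. *)
Definition is_relativization (U : membership) (V0 V1 : U -> Prop)
    (H : forall x, V0 x -> V1 x)
    (W : monoid_data (subclass V0)) (M : space (subclass V0)) (f : subclass V0)
    (W1 : monoid_data (subclass V1)) (M1 : space (subclass V1))
    (g : subclass V1) : Prop :=
  W1 = completion (map_monoid (incl H) W) /\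
  M1 = cc (map_monoid (incl H) W) (map_space (incl H) M) /\
  is_cc_map (map_monoid (incl H) W) (map_space (incl H) M) (incl H f) g.

(* Main.v *)
From Stdlib Require Import Classical ClassicalEpsilon FunctionalExtensionality
  PropExtensionality Arith.
Require Import Defs.

Set Implicit Arguments.
Unset Strict Implicit.

(** Write [P] for the set of positive elements of [W].  In the ground model
    consider all sequences [h : omega -> P] and give each of them two copies
    [(h,t0)] and [(h,t1)].  Two distinct points with first components [h] and
    [h'] are put at distance the infimum of the [h n] over those [n] up to
    which [h] and [h'] agree.  This is an ultrametric, and the map [f] that
    exchanges the two copies is an isometric involution without fixed point.
    The two copies of [h] are at distance the infimum of all the [h n], so [f]
    acquires a fixed point as soon as a sequence with infimum 0 appears.

    In the ground model there is no such sequence, since its running infima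
    would form an initial sequence of length omega, and the coinitiality of [W]
    exceeds omega ([seq_lower_bound]).  Hence distinct points have positive
    distance.  The same bound gives Cauchy completeness
    ([eventually_constant]): the terms of a Cauchy sequence settle at every
    index, the limit sequence has a positive lower bound, and late terms of the
    Cauchy sequence, whose mutual distances fall below this bound, are equal.

    In the larger model composing an initial sequence of [W] with a cofinal map
    from omega yields a sequence [r : omega -> P] with infimum 0.  Sequences of
    the ground model agree with [r] up to any given index ([truncation]), and
    choosing such an index in terms of a radius gives a Cauchy sequence [p]
    along which [f] moves points by less and less ([new_fixed_point]).  Because
    [f] is an isometric involution, applying it termwise preserves the distance
    of Cauchy sequences on the nose, and so induces the extension of [f] to the
    Cauchy completion ([cc_map_exists], [cc_map_isom]).  By the ultrametric
    inequality [p] and its termwise image have the same class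
    ([asymptotically_fixed]), which is therefore a fixed point.

    Two matters come from the axiomatic setting.  Separation holds only for
    first-order formulas, so each predicate used to form a set is shown to be
    definable; this is done by the closure properties of [definable] and
    [dterm], applied by the tactic [definability].  The ground model need not be
    definable in the larger one, so the facts about the space that are needed
    there are collected in [shift_system] in a form that refers only to the
    elements of the sets involved, and are carried over by [io_shift_system]. *)

(** * Definability and the basic set operations *)

Definition up (r : nat -> nat) (n : nat) : nat :=
  match n with O => O | S k => S (r k) end.

Fixpoint ren (r : nat -> nat) (p : formula) : formula :=
  match p with
  | FMem i j => FMem (r i) (r j)
  | FEq i j => FEq (r i) (r j)
  | FBot => FBot
  | FImp p q => FImp (ren r p) (ren r q)
  | FAll p => FAll (ren (up r) p)
  end.

Lemma sat_ren (X : membership) (p : formula) (r : nat -> nat) (e : nat -> X) :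
  sat e (ren r p) <-> sat (fun n => e (r n)) p.
Proof.
  revert r e; induction p as [i j|i j| |p IHp q IHq|p IH]; intros r e; simpl;
    try tauto.
  - rewrite IHp, IHq; tauto.
  - split; intros H x; specialize (H x); rewrite IH in *;
      replace (scons x (fun n => e (r n))) with (fun n => scons x e (up r n)) in *;
      auto; apply functional_extensionality; now intros [|n].
Qed.

Section Definability.
Context {X : membership}.
Implicit Types (e : nat -> X).

(** The variables of a formula are read through [s], either as entries of the
    environment or as parameters. *)
Definition val (s : nat -> nat + X) e (n : nat) : X :=
  match s n with inl k => e k | inr x => x end.

(** Definability with parameters, for predicates of environments.  A unary
    predicate is treated as one that depends on entry 0 only, and a binder
    shifts the remaining entries up by one. *)
Definition definable (Q : (nat -> X) -> Prop) : Prop :=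
  exists p s, forall e, Q e <-> sat (val s e) p.

Lemma definable_ext (Q R : (nat -> X) -> Prop) :
  (forall e, Q e <-> R e) -> definable R -> definable Q.
Proof.
  intros H (p & s & Hp); exists p, s; intros e; rewrite H; apply Hp.
Qed.

Lemma definable_ren (Q : (nat -> X) -> Prop) (r : nat -> nat) :
  definable Q -> definable (fun e => Q (fun n => e (r n))).
Proof.
  intros (p & s & Hp).
  exists p, (fun n => match s n with inl k => inl (r k) | inr x => inr x end).
  intros e; rewrite Hp.
  replace (val s (fun n => e (r n))) with
    (val (fun n => match s n with inl k => inl (r k) | inr x => inr x end) e);
    [tauto|].
  apply functional_extensionality; intros n; unfold val; now destruct (s n).
Qed.

Lemma definable_False : definable (fun _ => False).
Proof. exists FBot, (fun n => inl n); intros e; reflexivity. Qed.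

Lemma definable_var_mem (i j : nat) : definable (fun e => e i ∈ e j).
Proof. exists (FMem i j), (fun n => inl n); intros e; reflexivity. Qed.

Lemma definable_var_eq (i j : nat) : definable (fun e => e i = e j).
Proof. exists (FEq i j), (fun n => inl n); intros e; reflexivity. Qed.

Lemma definable_var_const (i : nat) (x : X) : definable (fun e => e i = x).
Proof.
  exists (FEq 0 1), (fun n => match n with O => inl i | _ => inr x end).
  intros e; reflexivity.
Qed.

Lemma definable_imp (P Q : (nat -> X) -> Prop) :
  definable P -> definable Q -> definable (fun e => P e -> Q e).
Proof.
  intros (p & s & Hp) (q & t & Hq).
  exists (FImp (ren (fun n => 2 * n) p) (ren (fun n => 2 * n + 1) q)).
  (* the two formulas are given disjoint variables, even and odd *)
  set (m := fun n => if Nat.even n then s (Nat.div2 n) else t (Nat.div2 n)).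
  exists m; intros e; cbn [sat]; rewrite !sat_ren, Hp, Hq.
  assert (E1 : (fun n => val m e (2 * n)) = val s e).
  { apply functional_extensionality; intros n; unfold m, val.
    now rewrite Nat.div2_double, Nat.even_mul. }
  assert (E2 : (fun n => val m e (2 * n + 1)) = val t e).
  { apply functional_extensionality; intros n; unfold m, val.
    now rewrite Nat.add_1_r, Nat.div2_succ_double, Nat.even_succ, Nat.odd_mul. }
  now rewrite E1, E2.
Qed.

(** Several variables of a formula may be read as entry 0 of the environment.
    Quantifying over that entry binds all of them together, so [bind] sends
    each to the bound variable. *)
Definition bind (s : nat -> nat + X) (n : nat) : nat :=
  match s n with inl O => O | _ => S n end.

Definition unshift (s : nat -> nat + X) (n : nat) : nat + X :=
  match s n with inl k => inl (pred k) | inr x => inr x end.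

Lemma val_bind (s : nat -> nat + X) (x : X) e :
  (fun n => scons x (val (unshift s) e) (bind s n)) = val s (scons x e).
Proof.
  apply functional_extensionality; intros n; unfold bind, unshift, val.
  destruct (s n) as [[|k]|y] eqn:E; simpl; trivial; now rewrite E.
Qed.

(** The hypothesis displays the body with the new variable at entry 0; the
    shifted environment is convertible to the old one, which keeps the goals
    produced by the tactic in beta-normal form. *)
Lemma definable_all (Q : (nat -> X) -> X -> Prop) :
  definable (fun e => Q (fun n => e (S n)) (e 0)) ->
  definable (fun e => forall x, Q e x).
Proof.
  intros (p & s & Hp); exists (FAll (ren (bind s) p)), (unshift s); intros e.
  simpl; split; intros H x.
  - rewrite sat_ren, val_bind, <- Hp; exact (H x).
  - specialize (H x); rewrite sat_ren, val_bind, <- Hp in H; exact H.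
Qed.

Lemma definable_const (P : Prop) : definable (fun _ => P).
Proof.
  destruct (classic P) as [H|H].
  - apply definable_ext with (fun _ => False -> False); [tauto|].
    apply definable_imp; apply definable_False.
  - apply definable_ext with (fun _ => False); [tauto|apply definable_False].
Qed.

Lemma definable_not (P : (nat -> X) -> Prop) :
  definable P -> definable (fun e => ~ P e).
Proof. intros H; apply definable_imp; [exact H|apply definable_False]. Qed.

Lemma definable_or (P Q : (nat -> X) -> Prop) :
  definable P -> definable Q -> definable (fun e => P e \/ Q e).
Proof.
  intros HP HQ; apply definable_ext with (fun e => ~ P e -> Q e).
  - intros e; tauto.
  - apply definable_imp; [apply definable_not|]; assumption.
Qed.

Lemma definable_and (P Q : (nat -> X) -> Prop) :
  definable P -> definable Q -> definable (fun e => P e /\ Q e).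
Proof.
  intros HP HQ; apply definable_ext with (fun e => ~ (P e -> ~ Q e)).
  - intros e; tauto.
  - apply definable_not, definable_imp; [|apply definable_not]; assumption.
Qed.

Lemma definable_iff (P Q : (nat -> X) -> Prop) :
  definable P -> definable Q -> definable (fun e => P e <-> Q e).
Proof. intros HP HQ; apply definable_and; apply definable_imp; assumption. Qed.

Lemma definable_ex (Q : (nat -> X) -> X -> Prop) :
  definable (fun e => Q (fun n => e (S n)) (e 0)) ->
  definable (fun e => exists x, Q e x).
Proof.
  intros H; apply definable_ext with (fun e => ~ forall x, ~ Q e x).
  - intros e; split; [firstorder|apply not_all_not_ex].
  - apply definable_not, definable_all, definable_not; exact H.
Qed.

(** A term is definable when its graph is. *)
Definition dterm (t : (nat -> X) -> X) : Prop :=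
  definable (fun e => e 0 = t (fun n => e (S n))).

Lemma dterm_var (i : nat) : dterm (fun e => e i).
Proof. apply (definable_var_eq 0 (S i)). Qed.

Lemma dterm_const (x : X) : dterm (fun _ => x).
Proof. apply (definable_var_const 0 x). Qed.

Lemma dterm_ren (r : nat -> nat) (t : (nat -> X) -> X) :
  dterm t -> dterm (fun e => t (fun n => e (r n))).
Proof. exact (@definable_ren _ (up r)). Qed.

Lemma definable_subst (Q : (nat -> X) -> X -> Prop) (t : (nat -> X) -> X) :
  dterm t -> definable (fun e => Q (fun n => e (S n)) (e 0)) ->
  definable (fun e => Q e (t e)).
Proof.
  intros Ht HQ; apply definable_ext with (fun e => exists x, x = t e /\ Q e x).
  - intros e; split; [eauto|intros (x & -> & H); exact H].
  - apply definable_ex, definable_and; assumption.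
Qed.

Lemma definable_eq (s t : (nat -> X) -> X) :
  dterm s -> dterm t -> definable (fun e => s e = t e).
Proof. intros Hs Ht; apply (definable_subst (Q := fun e x => x = t e)) ; assumption. Qed.

Lemma definable_mem (s t : (nat -> X) -> X) :
  dterm s -> dterm t -> definable (fun e => s e ∈ t e).
Proof.
  intros Hs Ht; apply (definable_subst (Q := fun e x => x ∈ t e)); [exact Hs|].
  apply (definable_subst (Q := fun e x => e 0 ∈ x)); [exact (dterm_ren S Ht)|].
  apply (definable_var_mem 1 0).
Qed.

(** The witness that [the] takes is a proof of inhabitation, so proof
    irrelevance removes it.  In particular all descriptions without a solution
    denote the same element. *)
Lemma the_ext (a b : X) (P Q : X -> Prop) :
  (forall x, P x <-> Q x) -> the a P = the b Q.
Proof.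
  intros H; replace Q with P.
  - unfold the; now rewrite (proof_irrelevance _ (inhabits a) (inhabits b)).
  - apply functional_extensionality; intros x; now apply propositional_extensionality.
Qed.

Lemma the_spec (a : X) (P : X -> Prop) : (exists x, P x) -> P (the a P).
Proof. apply epsilon_spec. Qed.

Lemma the_eq (a x : X) (P : X -> Prop) :
  P x -> (forall y, P y -> y = x) -> the a P = x.
Proof. intros H U; apply U, the_spec; eauto. Qed.

(** If the description has no solution its value is a fixed element, by
    [the_ext], and that element can be used as a parameter of the formula. *)
Lemma dterm_the (a : (nat -> X) -> X) (P : (nat -> X) -> X -> Prop) :
  (forall e x y, P e x -> P e y -> x = y) ->
  definable (fun e => P (fun n => e (S n)) (e 0)) ->
  dterm (fun e => the (a e) (P e)).
Proof.
  intros U HP; destruct (classic (exists z : X, True)) as [[z _]|N].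
  (* the graph: a solution, or the default value if there is none *)
  - apply definable_ext with (fun e => P (fun n => e (S n)) (e 0) \/
      (~ exists x, P (fun n => e (S n)) x) /\ e 0 = the z (fun _ => False)).
    + intros e; set (e' := fun n => e (S n)).
      destruct (classic (exists x, P e' x)) as [Hx|Hx].
      * pose proof (the_spec (a e') Hx) as H; split.
        -- intros ->; tauto.
        -- intros [H1|[H1 _]]; [exact (U _ _ _ H1 H)|tauto].
      * replace (the (a e') (P e')) with (the z (fun _ => False)).
        -- split; [tauto|intros [H|H]; [firstorder|tauto]].
        -- apply the_ext; firstorder.
    + apply definable_or; [exact HP|]. apply definable_and.
      * apply definable_not, definable_ex.
        exact (definable_ren
                 (fun n => match n with O => O | S k => S (S k) end) HP).
      * apply definable_eq; [apply dterm_var|apply dterm_const].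
  - apply definable_ext with (fun _ => True); [|apply definable_const].
    intros e; exfalso; apply N; now exists (e 0).
Qed.

End Definability.

Section Basics.
Context {X : membership} (HX : ZFC X).
Implicit Types (a b c f p q s t x y z A B : X) (P : X -> Prop).

Lemma set_ext a b : (forall x, x ∈ a <-> x ∈ b) -> a = b.
Proof. apply HX. Qed.

Lemma in_upair a b x : x ∈ upair a b <-> x = a \/ x = b.
Proof.
  destruct HX as (_ & _ & H & _).
  exact (the_spec a (H a b) x).
Qed.

Lemma in_power a x : x ∈ power a <-> subset x a.
Proof.
  destruct HX as (_ & _ & _ & _ & H & _).
  exact (the_spec a (H a) x).
Qed.

Lemma in_sep a P :
  definable (fun e => P (e 0)) -> forall x, x ∈ sep a P <-> x ∈ a /\ P x.
Proof.
  intros (p & s & Hp).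
  destruct HX as (_ & _ & _ & _ & _ & _ & H & _).
  apply (the_spec a (P := fun b => forall x, x ∈ b <-> x ∈ a /\ P x)).
  destruct (H (ren (bind s) p) (val (unshift s) (fun _ => a)) a) as (b & Hb).
  exists b; intros x; rewrite (Hb x), sat_ren, val_bind, <- Hp; simpl; tauto.
Qed.

(** Lets a predicate that is definable only on [a] be replaced by one that is
    definable everywhere. *)
Lemma sep_ext a P (Q : X -> Prop) :
  (forall x, x ∈ a -> P x <-> Q x) -> sep a P = sep a Q.
Proof.
  intros H; apply the_ext; intros b; split; intros E x; rewrite E;
    split; intros [Hx K]; split; auto; now apply H.
Qed.

Lemma regular_el a x :
  x ∈ a -> exists y, y ∈ a /\ forall z, z ∈ y -> ~ z ∈ a.
Proof. destruct HX as (_ & H & _); intros Hx; apply H; eauto. Qed.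

Lemma pair_inj a b c d : pair a b = pair c d -> a = c /\ b = d.
Proof.
  intros E.
  assert (H : forall x, x ∈ pair a b <-> x = upair c c \/ x = upair c d)
    by (intros x; rewrite E; apply in_upair).
  assert (U : forall u v w : X, upair u u = upair v w -> u = v /\ u = w).
  { intros u v w Eu; split; symmetry; 
    cut (v ∈ upair u u /\ w ∈ upair u u); try (rewrite !in_upair; tauto);
    rewrite Eu, !in_upair; tauto. }
  assert (A1 : upair a a = upair c c \/ upair a a = upair c d)
    by (apply H, in_upair; auto).
  assert (Eac : a = c) by (destruct A1 as [A1|A1]; apply U in A1; tauto).
  subst c; split; [reflexivity|].
  assert (A2 : upair a b = upair a a \/ upair a b = upair a d)
    by (apply H, in_upair; auto).
  assert (A3 : upair a d = upair a a \/ upair a d = upair a b)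
    by (apply in_upair; fold (pair a b); rewrite E; apply in_upair; auto).
  assert (B1 : b = a \/ b = d).
  { assert (Hb : b ∈ upair a b) by (apply in_upair; auto).
    destruct A2 as [A2|A2]; rewrite A2, in_upair in Hb; tauto. }
  assert (B2 : d = a \/ d = b).
  { assert (Hd : d ∈ upair a d) by (apply in_upair; auto).
    destruct A3 as [A3|A3]; rewrite A3, in_upair in Hd; tauto. }
  destruct B1, B2; congruence.
Qed.

Lemma dterm_upair (s t : (nat -> X) -> X) :
  dterm s -> dterm t -> dterm (fun e => upair (s e) (t e)).
Proof.
  intros Hs Ht; apply definable_ext with
    (fun e => forall x, x ∈ e 0 <->
       x = s (fun n => e (S n)) \/ x = t (fun n => e (S n))).
  - intros e; split.
    + intros ->; apply in_upair.
    + intros H; apply set_ext; intros x; rewrite H, in_upair; tauto.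
  - apply definable_all, definable_iff.
    + apply definable_var_mem.
    + apply definable_or; apply definable_eq; try apply dterm_var;
      apply (dterm_ren (fun n => S (S n))); assumption.
Qed.

Lemma dterm_pair (s t : (nat -> X) -> X) :
  dterm s -> dterm t -> dterm (fun e => pair (s e) (t e)).
Proof. intros Hs Ht; unfold pair; now repeat apply dterm_upair. Qed.

Lemma dterm_sep (t : (nat -> X) -> X) (P : (nat -> X) -> X -> Prop) :
  dterm t -> definable (fun e => P (fun n => e (S n)) (e 0)) ->
  dterm (fun e => sep (t e) (P e)).
Proof.
  intros Ht HP; apply dterm_the.
  - intros e x y H1 H2; apply set_ext; intros z; rewrite H1, H2; tauto.
  - apply definable_all, definable_iff.
    + apply definable_var_mem.
    + apply definable_and.
      * apply definable_mem; [apply dterm_var|].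
        exact (dterm_ren (fun n => S (S n)) Ht).
      * exact (definable_ren
                 (fun n => match n with O => O | S k => S (S k) end) HP).
Qed.

(** Here [f] is a parameter, and the arguments outside its domain are covered
    by the convention on descriptions without solution. *)
Lemma dterm_app_const f (t : (nat -> X) -> X) :
  (forall x y y', pair x y ∈ f -> pair x y' ∈ f -> y = y') ->
  dterm t -> dterm (fun e => app f (t e)).
Proof.
  intros U Ht; apply dterm_the.
  - intros e x y; apply U.
  - apply definable_mem; [|apply dterm_const].
    apply dterm_pair; [exact (dterm_ren S Ht)|apply dterm_var].
Qed.

End Basics.

#[export] Hint Unfold subset in_dom is_func wle wadd app2 d is_inf is_sup
  unique wpos : dfn.

Ltac dstep_more := fail.

Ltac dstep :=
  cbv beta;
  match goal with
  | H : definable _ |- definable _ => exact H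
  | H : definable (fun e => ?P (fun n => e (S n)) (e 0))
    |- definable (fun e => ?P (fun n => e (@?r n)) (e ?k)) =>
      exact (definable_ren (fun n => match n with O => k | S m => r m end) H)
  | H : definable (fun e => ?P (e 0)) |- definable (fun e => ?P (e ?k)) =>
      exact (definable_ren (fun _ => k) H)
  | |- definable (fun _ => ?P) => apply (definable_const P)
  | |- definable (fun e => @?P e /\ @?Q e) => apply (@definable_and _ P Q)
  | |- definable (fun e => @?P e \/ @?Q e) => apply (@definable_or _ P Q)
  | |- definable (fun e => @?P e <-> @?Q e) => apply (@definable_iff _ P Q)
  | |- definable (fun e => ~ @?P e) => apply (@definable_not _ P)
  | |- definable (fun e => exists x, @?P e x) => apply (@definable_ex _ P)
  | |- definable (fun e => @?s e = @?t e) => apply (@definable_eq _ s t)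
  | |- definable (fun e => @?s e ∈ @?t e) => apply (@definable_mem _ s t)
  | |- definable (fun e => @?P e -> @?Q e) => apply (@definable_imp _ P Q)
  | |- definable (fun e => forall x, @?P e x) => apply (@definable_all _ P)
  | |- dterm (fun _ => ?c) => apply (dterm_const c)
  | |- dterm (fun e => e ?n) => apply (dterm_var n)
  | H : dterm ?t |- dterm (fun e => ?t _) => apply (dterm_ren _ H)
  | HX : ZFC _ |- dterm (fun e => pair _ _) => apply (dterm_pair HX)
  | HX : ZFC _ |- dterm (fun e => upair _ _) => apply (dterm_upair HX)
  | HX : ZFC _ |- dterm (fun e => sep (@?t e) (@?P e)) =>
      apply (@dterm_sep _ HX t P)
  | HX : ZFC _ |- dterm (fun e => app _ _) =>
      apply (dterm_app_const HX); [solve [eauto]|]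
  | _ => dstep_more
  end.
Ltac definability := repeat (autounfold with dfn; dstep).

Section Basics2.
Context {X : membership} (HX : ZFC X).
Implicit Types (a b c f p q s t x y z A B : X) (P : X -> Prop).

(** Pairs of elements of [a] and [b] lie in the double power set of the union
    of [a] and [b], which makes Separation applicable. *)
Lemma in_prod a b t :
  t ∈ prod a b <-> exists x y, x ∈ a /\ y ∈ b /\ t = pair x y.
Proof.
  revert t; unfold prod.
  apply (the_spec a (P := fun c => forall t,
    t ∈ c <-> exists x y, x ∈ a /\ y ∈ b /\ t = pair x y)).
  pose proof HX as (_ & _ & _ & HU & _).
  destruct (HU (upair a b)) as (u & Hu).
  exists (sep (power (power u))
           (fun t => exists x y, x ∈ a /\ y ∈ b /\ t = pair x y)).
  intros t; rewrite in_sep; [|assumption|definability].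
  split; [tauto|]; intros (x & y & Hx & Hy & ->); split; [|now exists x, y].
  assert (Ux : x ∈ u) by (apply Hu; exists a; rewrite in_upair; auto).
  assert (Uy : y ∈ u) by (apply Hu; exists b; rewrite in_upair; auto).
  apply in_power; [assumption|]; intros z; unfold pair; rewrite in_upair; [|assumption].
  intros Hz; apply in_power; [assumption|]; intros v.
  destruct Hz as [-> | ->]; rewrite in_upair by assumption; intros [-> | ->]; assumption.
Qed.

Lemma in_prod_pair a b x y : pair x y ∈ prod a b <-> x ∈ a /\ y ∈ b.
Proof.
  rewrite in_prod; split.
  - intros (x' & y' & Hx & Hy & E); apply (pair_inj HX) in E; destruct E; subst; auto.
  - intros []; now exists x, y.
Qed.

Lemma dterm_prod (s t : (nat -> X) -> X) :
  dterm s -> dterm t -> dterm (fun e => prod (s e) (t e)).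
Proof.
  intros Hs Ht; apply dterm_the.
  - intros e x y H1 H2; apply (set_ext HX); intros z; rewrite H1, H2; tauto.
  - definability.
Qed.

Lemma func_dom f a b x y : is_func f a b -> pair x y ∈ f -> x ∈ a /\ y ∈ b.
Proof.
  intros [H _] Hxy; apply H in Hxy; destruct Hxy as (x' & y' & Hx & Hy & E).
  apply (pair_inj HX) in E; destruct E; subst; auto.
Qed.

Lemma func_fun f a b x y y' :
  is_func f a b -> pair x y ∈ f -> pair x y' ∈ f -> y = y'.
Proof.
  intros H H1 H2; pose proof (func_dom H H1) as [Hx _].
  destruct H as [_ H]; destruct (H x Hx) as (z & _ & U).
  rewrite <- (U y H1); auto.
Qed.

Lemma app_pair f a b x : is_func f a b -> x ∈ a -> pair x (app f x) ∈ f.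
Proof.
  intros [_ H] Hx; destruct (H x Hx) as (y & Hy & _).
  apply (the_spec x (P := fun y => pair x y ∈ f)); eauto.
Qed.

Lemma app_in f a b x : is_func f a b -> x ∈ a -> app f x ∈ b.
Proof. intros H Hx; eapply func_dom, app_pair; eauto. Qed.

Lemma app_eq f a b x y : is_func f a b -> pair x y ∈ f -> app f x = y.
Proof.
  intros H Hxy; eapply func_fun; [exact H| |exact Hxy].
  eapply app_pair; [exact H|]. now apply (func_dom H Hxy).
Qed.

Lemma func_ext f g a b b' : is_func f a b -> is_func g a b' ->
  (forall x, x ∈ a -> app f x = app g x) -> f = g.
Proof.
  intros Hf Hg E; apply (set_ext HX); intros t; split; intros Ht.
  - destruct (proj1 Hf t Ht) as (x & y & Hx & Hy & ->).
    rewrite <- (app_eq Hf Ht), E by assumption; eapply app_pair; eassumption.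
  - destruct (proj1 Hg t Ht) as (x & y & Hx & Hy & ->).
    rewrite <- (app_eq Hg Ht), <- E by assumption; eapply app_pair; eassumption.
Qed.

Lemma func_power f a b : is_func f a b -> f ∈ power (prod a b).
Proof.
  intros Hf; apply in_power; [assumption|]; intros t Ht.
  apply in_prod; now apply Hf.
Qed.

(** Functions are separated from the product, so that Replacement is avoided
    in favour of an explicit codomain. *)
Lemma func_sep a b (R : X -> X -> Prop) :
  definable (fun e => R (e 0) (e 1)) ->
  (forall x, x ∈ a -> exists y, y ∈ b /\ R x y) ->
  (forall x y y', x ∈ a -> R x y -> R x y' -> y = y') ->
  let f := sep (prod a b) (fun t => exists x y, t = pair x y /\ R x y) in
  is_func f a b /\ forall x, x ∈ a -> R x (app f x).
Proof.
  intros D E U f.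
  assert (Hf : forall t, t ∈ f <->
    t ∈ prod a b /\ exists x y, t = pair x y /\ R x y).
  { apply in_sep; [assumption|]; definability.
    apply (definable_ren (fun n => match n with 0 => 1 | 1 => 0 | S k => S k end) D). }
  assert (Hp : forall x y, pair x y ∈ f <-> x ∈ a /\ y ∈ b /\ R x y).
  { intros x y; rewrite Hf, in_prod_pair; split.
    - intros (H & x' & y' & E' & H'); apply (pair_inj HX) in E'.
      destruct E'; subst; tauto.
    - intros (? & ? & ?); split; eauto. }
  assert (F : is_func f a b).
  { split.
    - intros t Ht; apply in_prod, Hf, Ht.
    - intros x Hx; destruct (E x Hx) as (y & Hy & Hr); exists y; split.
      + apply Hp; auto.
      + intros y' H; apply Hp in H; eapply U; [exact Hx|exact Hr|tauto]. }
  split; [exact F|]; intros x Hx; apply Hp; eapply app_pair; eauto.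
Qed.

Lemma func_exists a b (R : X -> X -> Prop) :
  definable (fun e => R (e 0) (e 1)) ->
  (forall x, x ∈ a -> exists y, y ∈ b /\ R x y) ->
  (forall x y y', x ∈ a -> R x y -> R x y' -> y = y') ->
  exists f, is_func f a b /\ forall x, x ∈ a -> R x (app f x).
Proof. intros D E U; eexists; apply (func_sep (b := b) D E U). Qed.

(** Where [f] is multivalued, [app f x] is an arbitrary choice and need not be
    definable from [f].  This variant always is, and it agrees with [app] on
    functions. *)
Definition uapp f x : X :=
  the x (fun y => pair x y ∈ f /\ forall y', pair x y' ∈ f -> y' = y).

Lemma app_uapp f a b x : is_func f a b -> x ∈ a -> app f x = uapp f x.
Proof.
  intros H Hx; apply the_ext; intros y; split; [|tauto].
  intros Hy; split; [exact Hy|]; intros y' Hy'; eapply func_fun; eauto.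
Qed.

Lemma dterm_uapp (s t : (nat -> X) -> X) :
  dterm s -> dterm t -> dterm (fun e => uapp (s e) (t e)).
Proof.
  intros Hs Ht; apply dterm_the.
  - intros e x y [H1 H2] [H3 H4]; auto.
  - definability.
Qed.

End Basics2.

Ltac dstep_more ::=
  match goal with
  | HX : ZFC _ |- dterm (fun e => prod _ _) => apply (dterm_prod HX)
  | HX : ZFC _ |- dterm (fun e => uapp _ _) => apply (dterm_uapp HX)
  end.

(** * The first infinite ordinal *)

Section Omega.
Context {X : membership} (HX : ZFC X).
Implicit Types (a b c f p q s t x y z A B k m n : X).

Lemma mem_irrefl x : ~ x ∈ x.
Proof.
  intros H; destruct (@regular_el X HX (upair x x) x) as (y & Hy & N).
  - apply in_upair; auto.
  - apply in_upair in Hy; [|assumption].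
    apply (N x); [|apply in_upair; auto]. destruct Hy; subst; assumption.
Qed.

(** Only definable predicates are covered: the models may be ill-founded from
    outside. *)
Lemma mem_ind a (P : X -> Prop) : definable (fun e => P (e 0)) ->
  (forall x y, x ∈ a -> y ∈ x -> y ∈ a) ->
  (forall x, x ∈ a -> (forall y, y ∈ x -> P y) -> P x) ->
  forall x, x ∈ a -> P x.
Proof.
  intros D T H x Hx; apply NNPP; intros N.
  assert (S : forall y, y ∈ sep a (fun x => ~ P x) <-> y ∈ a /\ ~ P y)
    by (apply in_sep; [assumption|definability]).
  destruct (@regular_el X HX (sep a (fun x => ~ P x)) x) as (y & Hy & M).
  - apply S; auto.
  - apply S in Hy; destruct Hy as [Hy Ny]; apply Ny, H; [exact Hy|].
    intros z Hz; apply NNPP; intros Nz; apply (M z Hz), S; split; eauto.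
Qed.

Definition is_zero n : Prop := forall x, ~ x ∈ n.
Definition is_succ m n : Prop := forall x, x ∈ n <-> x ∈ m \/ x = m.

Context (w : X) (Hw : is_omega w).

Lemma omega_trans n k : n ∈ w -> k ∈ n -> k ∈ w.
Proof. apply Hw. Qed.

Lemma omega_mem_trans k m n : n ∈ w -> k ∈ m -> m ∈ n -> k ∈ n.
Proof.
  intros Hn Hk Hm; assert (Hm' : m ∈ w) by (eapply omega_trans; eauto).
  destruct Hw as (((_ & T & _) & _) & _); apply (T k m n); auto.
  eapply omega_trans; eauto.
Qed.

Lemma omega_tri m n : m ∈ w -> n ∈ w -> m ∈ n \/ m = n \/ n ∈ m.
Proof. destruct Hw as (((_ & _ & T & _) & _) & _); apply T. Qed.

(** An element of omega that is neither empty nor has a largest element would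
    be a limit ordinal. *)
Lemma omega_cases n :
  n ∈ w -> is_zero n \/ exists m, m ∈ w /\ is_succ m n.
Proof.
  intros Hn; destruct (classic (is_zero n)) as [Z|Z]; [now left|right].
  assert (O : is_ordinal n).
  { repeat split.
    - intros x y Hx Hy; exact (omega_mem_trans Hn Hy Hx).
    - intros x y z _ _ Hz Hxy Hyz.
      eapply omega_mem_trans; [eapply omega_trans|..]; eassumption.
    - intros x y Hx Hy; apply omega_tri; eapply omega_trans; eassumption.
    - intros b _ (x & Hx); destruct (regular_el HX Hx) as (y & Hy & N).
      exists y; split; [exact Hy|]; intros z Hz Hzy; exact (N z Hzy Hz). }
  apply not_all_ex_not in Z; destruct Z as (z & Hz); apply NNPP in Hz.
  destruct Hw as [_ L]; specialize (L n Hn).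
  assert (M : ~ forall x, x ∈ n -> exists y, y ∈ n /\ x ∈ y)
    by (intros M; apply L; repeat split; eauto; apply O).
  apply not_all_ex_not in M; destruct M as (m & M).
  apply imply_to_and in M; destruct M as [Hm M].
  exists m; split; [eapply omega_trans; eassumption|].
  intros x; split.
  - intros Hx; destruct (@omega_tri x m) as [H|[H|H]]; auto;
      try (eapply omega_trans; eassumption).
    exfalso; eauto.
  - intros [Hx| ->]; [exact (omega_mem_trans Hn Hx Hm)|exact Hm].
Qed.

Lemma omega_zero : exists n, n ∈ w /\ is_zero n.
Proof.
  destruct Hw as ((_ & (x & Hx) & _) & _).
  destruct (regular_el HX Hx) as (y & Hy & N); exists y; split; [exact Hy|].
  intros z Hz; apply (N z Hz); eapply omega_trans; eassumption.
Qed.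

(** The successor is the least element of omega above [m]. *)
Lemma omega_succ m : m ∈ w -> exists n, n ∈ w /\ is_succ m n.
Proof.
  intros Hm; pose proof Hw as ((_ & _ & L) & _).
  destruct (L m Hm) as (y & Hy & Hmy).
  assert (S : forall x, x ∈ sep w (fun x => m ∈ x) <-> x ∈ w /\ m ∈ x)
    by (apply in_sep; [assumption|definability]).
  destruct (@regular_el X HX (sep w (fun x => m ∈ x)) y) as (n & Hn & N);
    [apply S; auto|].
  apply S in Hn; destruct Hn as [Hn Hmn].
  exists n; split; [exact Hn|]; intros x; split.
  - intros Hx; pose proof (omega_trans Hn Hx) as Hx'.
    destruct (omega_tri Hx' Hm) as [H|[H|H]]; auto.
    exfalso; apply (N x Hx), S; auto.
  - intros [Hx| ->]; [exact (omega_mem_trans Hn Hx Hmn)|exact Hmn].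
Qed.

Lemma omega_ind (P : X -> Prop) : definable (fun e => P (e 0)) ->
  (forall n, n ∈ w -> is_zero n -> P n) ->
  (forall m n, m ∈ w -> n ∈ w -> is_succ m n -> P m -> P n) ->
  forall n, n ∈ w -> P n.
Proof.
  intros D H0 HS; apply mem_ind; [exact D|apply Hw|].
  intros n Hn IH; destruct (omega_cases Hn) as [Z|(m & Hm & S)]; [auto|].
  eapply HS; eauto; apply IH, S; auto.
Qed.

Lemma omega_least (P : X -> Prop) n : definable (fun e => P (e 0)) ->
  n ∈ w -> P n ->
  exists m, m ∈ w /\ P m /\ forall k, k ∈ m -> ~ P k.
Proof.
  intros D Hn Pn; apply NNPP; intros N.
  apply (@mem_ind w (fun n => ~ P n)) with n; auto; [definability|apply Hw|].
  intros x Hx IH Px; apply N; eauto.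
Qed.

Definition upto k n : Prop := k ∈ n \/ k = n.

End Omega.

(** Identifies the omega of the ground model with that of the larger model. *)
Lemma omega_unique (X : membership) (HX : ZFC X) (w w' : X) :
  is_omega w -> is_omega w' -> w = w'.
Proof.
  assert (H : forall w w' : X, is_omega w -> is_omega w' -> subset w w').
  { intros u v Hu Hv; refine (omega_ind HX Hu (P := fun n => n ∈ v) _ _ _); [definability|..].
    - intros n Hn Z; destruct (omega_zero HX Hv) as (n' & Hn' & Z').
      replace n with n'; [exact Hn'|]; apply (set_ext HX); firstorder.
    - intros m n Hm Hn S Hm'; destruct (omega_succ HX Hv Hm') as (n' & Hn' & S').
      replace n with n'; [exact Hn'|]; apply (set_ext HX); intros x.
      rewrite (S x), (S' x); tauto. }
  intros Hw Hw'; apply (set_ext HX); intros x; split; apply H; assumption.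
Qed.

(** * The isometric involution in the ground model *)

(** The axioms of distance monoids that speak of elements of the carrier only,
    and therefore persist to a larger model; infima of arbitrary subsets are
    left out because new subsets may appear. *)
Definition ordered_monoid (X : membership) (W : monoid_data X) : Prop :=
  is_commutative_monoid W /\
  is_linear_order W /\
  (forall a, a ∈ car W -> wle W (zero W) a) /\
  (forall a b c, c ∈ car W -> wle W a b ->
     wle W (wadd W c a) (wadd W c b) /\ wle W (wadd W a c) (wadd W b c)).

Lemma distance_monoid_ordered (X : membership) (W : monoid_data X) :
  is_distance_monoid W -> ordered_monoid W.
Proof. intros (H1 & H2 & H3 & H4 & _); exact (conj H1 (conj H2 (conj H3 H4))). Qed.

Section Extrema.
Context {X : membership} (W : monoid_data X).
Context (anti : forall a b : X, wle W a b -> wle W b a -> a = b).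
Implicit Types (x y : X).

Lemma is_inf_unique (P : X -> Prop) x y : is_inf W P x -> is_inf W P y -> x = y.
Proof.
  intros (Hx & Lx & Gx) (Hy & Ly & Gy); apply anti; auto.
Qed.

Lemma is_sup_unique (P : X -> Prop) x y : is_sup W P x -> is_sup W P y -> x = y.
Proof.
  intros (Hx & Lx & Gx) (Hy & Ly & Gy); apply anti; auto.
Qed.

Lemma winf_eq (P : X -> Prop) x : is_inf W P x -> winf W P = x.
Proof. intros H; apply the_eq; [exact H|]; intros y Hy; exact (is_inf_unique Hy H). Qed.

Lemma wsup_eq (P : X -> Prop) x : is_sup W P x -> wsup W P = x.
Proof. intros H; apply the_eq; [exact H|]; intros y Hy; exact (is_sup_unique Hy H). Qed.

Lemma dterm_winf (P : (nat -> X) -> X -> Prop) : ZFC X ->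
  definable (fun e => P (fun n => e (S n)) (e 0)) ->
  dterm (fun e => winf W (P e)).
Proof.
  intros HX D; apply dterm_the; [intros e x y; apply is_inf_unique|].
  definability.
Qed.

Lemma dterm_wsup (P : (nat -> X) -> X -> Prop) : ZFC X ->
  definable (fun e => P (fun n => e (S n)) (e 0)) ->
  dterm (fun e => wsup W (P e)).
Proof.
  intros HX D; apply dterm_the; [intros e x y; apply is_sup_unique|].
  definability.
Qed.

End Extrema.

Section Order.
Context {X : membership} (HX : ZFC X) (W : monoid_data X).
Context (OM : ordered_monoid W).
Implicit Types (a b c f p q s t x y z A B k m n : X).

Lemma in_wpos a : a ∈ wpos W <-> a ∈ car W /\ a <> zero W.
Proof. unfold wpos; rewrite in_sep; [tauto|assumption|definability]. Qed.

Lemma wpos_car a : a ∈ wpos W -> a ∈ car W.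
Proof. rewrite in_wpos; tauto. Qed.

Lemma zero_car : zero W ∈ car W.
Proof. apply OM. Qed.

Lemma wle_car a b : wle W a b -> a ∈ car W /\ b ∈ car W.
Proof.
  destruct OM as (_ & (S & _) & _); intros H; apply S in H.
  now apply in_prod_pair in H.
Qed.

Lemma wle_refl a : a ∈ car W -> wle W a a.
Proof. destruct OM as (_ & (_ & H & _) & _); apply H. Qed.

Lemma wle_antisym a b : wle W a b -> wle W b a -> a = b.
Proof. destruct OM as (_ & (_ & _ & H & _) & _); apply H. Qed.

Lemma wle_trans a b c : wle W a b -> wle W b c -> wle W a c.
Proof. destruct OM as (_ & (_ & _ & _ & H & _) & _); apply H. Qed.

Lemma wle_total a b : a ∈ car W -> b ∈ car W -> wle W a b \/ wle W b a.
Proof. destruct OM as (_ & (_ & _ & _ & _ & H) & _); apply H. Qed.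

Lemma not_wle a b : a ∈ car W -> b ∈ car W -> ~ wle W a b -> wle W b a.
Proof. intros Ha Hb N; destruct (wle_total Ha Hb); tauto. Qed.

Lemma zero_wle a : a ∈ car W -> wle W (zero W) a.
Proof. apply OM. Qed.

Lemma wle_zero a : wle W a (zero W) -> a = zero W.
Proof.
  intros H; apply wle_antisym; [exact H|]; apply zero_wle; now apply wle_car in H.
Qed.

Lemma wpos_up a b : a ∈ wpos W -> wle W a b -> b ∈ wpos W.
Proof.
  rewrite !in_wpos; intros [Ha N] H; pose proof (wle_car H); split; [tauto|].
  intros ->; now apply N, wle_zero.
Qed.

Lemma wadd_car a b : a ∈ car W -> b ∈ car W -> wadd W a b ∈ car W.
Proof.
  intros Ha Hb; destruct OM as ((F & _) & _).
  apply (app_in HX F); now apply in_prod_pair.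
Qed.

Lemma wadd_comm a b : a ∈ car W -> b ∈ car W -> wadd W a b = wadd W b a.
Proof. destruct OM as ((_ & _ & _ & C & _) & _); apply C. Qed.

Lemma wadd_zero_l a : a ∈ car W -> wadd W (zero W) a = a.
Proof. destruct OM as ((_ & _ & _ & _ & C) & _); apply C. Qed.

Lemma wadd_mono a a' b b' :
  wle W a a' -> wle W b b' -> wle W (wadd W a b) (wadd W a' b').
Proof.
  intros Ha Hb; pose proof (wle_car Ha); pose proof (wle_car Hb).
  apply wle_trans with (wadd W a' b); apply OM; tauto.
Qed.

Lemma wle_addr a b : a ∈ car W -> b ∈ car W -> wle W b (wadd W a b).
Proof.
  intros Ha Hb; rewrite <- (wadd_zero_l Hb) at 1.
  apply wadd_mono; [now apply zero_wle|now apply wle_refl].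
Qed.

Lemma wle_addl a b : a ∈ car W -> b ∈ car W -> wle W a (wadd W a b).
Proof. intros Ha Hb; rewrite wadd_comm by assumption; now apply wle_addr. Qed.

Lemma wpos_min a b : a ∈ wpos W -> b ∈ wpos W ->
  exists c, c ∈ wpos W /\ wle W c a /\ wle W c b.
Proof.
  intros Ha Hb; pose proof (wpos_car Ha); pose proof (wpos_car Hb).
  destruct (@wle_total a b) as [H1|H1]; auto;
    [exists a|exists b]; auto using wle_refl.
Qed.

(** By linearity a sum of two elements is bounded below by twice the smaller
    one. *)
Lemma small_sum A x : subset A (car W) ->
  is_inf W (fun x => exists a b, a ∈ A /\ b ∈ A /\ x = wadd W a b) (zero W) ->
  x ∈ wpos W -> exists a, a ∈ A /\ ~ wle W x (wadd W a a).
Proof.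
  intros S (_ & _ & G) Hx; apply in_wpos in Hx; destruct Hx as [Hx Nx].
  apply NNPP; intros N; apply Nx, wle_zero, G; [exact Hx|].
  intros y (a & b & Ha & Hb & ->).
  destruct (@wle_total a b) as [L|L]; try (apply S; assumption).
  - apply wle_trans with (wadd W a a).
    + apply NNPP; intros N1; apply N; eauto.
    + apply wadd_mono; auto using wle_refl.
  - apply wle_trans with (wadd W b b).
    + apply NNPP; intros N1; apply N; eauto.
    + apply wadd_mono; auto using wle_refl.
Qed.

Context (HC : continuous_at_0 W).

Lemma wpos_half x : x ∈ wpos W ->
  exists a, a ∈ wpos W /\ ~ wle W x (wadd W a a).
Proof. apply small_sum; [|exact HC]; intros y; apply wpos_car. Qed.

Lemma wpos_smaller x : x ∈ wpos W ->
  exists a, a ∈ wpos W /\ wle W a x /\ ~ wle W x a.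
Proof.
  intros Hx; destruct (wpos_half Hx) as (a & Ha & N); exists a; split; [exact Ha|].
  pose proof (wpos_car Ha); pose proof (wpos_car Hx).
  assert (M : ~ wle W x a).
  { intros L; apply N, wle_trans with a; auto using wle_addl. }
  split; [|exact M]; now apply not_wle.
Qed.

Lemma wle_all_pos x : x ∈ car W -> (forall e, e ∈ wpos W -> wle W x e) -> x = zero W.
Proof.
  intros Hx H; apply NNPP; intros N.
  assert (Px : x ∈ wpos W) by (apply in_wpos; auto).
  destruct (wpos_smaller Px) as (a & Ha & _ & M); auto.
Qed.

(** The radii of a Cauchy sequence are coinitial in the positive elements. *)
Lemma small_radius A x : subset A (wpos W) ->
  is_inf W (fun x => exists a b, a ∈ A /\ b ∈ A /\ x = wadd W a b) (zero W) ->
  x ∈ wpos W -> exists a, a ∈ A /\ wle W a x.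
Proof.
  intros S I Hx; assert (S' : subset A (car W)) by (intros y Hy; apply wpos_car; auto).
  destruct (small_sum S' I Hx) as (a & Ha & N); exists a; split; [exact Ha|].
  apply not_wle; auto using wpos_car; intros L; apply N.
  apply wle_trans with a; auto using wle_addl.
Qed.

End Order.

(** The interface between the two models.  The only upper bound on distances
    is [ss_agree].  The fields [ss_const] and [ss_update] express closure
    under finite changes one step at a time, because finite approximations
    will be built by an induction inside the larger model, where the ground
    model is not definable but the set [N] is available as a parameter. *)
Record shift_system (X : membership) (W : monoid_data X) (M : space X)
    (f N w t0 t1 : X) : Prop := ShiftSystem {
  ss_pts : forall x, x ∈ pts M <->
    exists h i, h ∈ N /\ (i = t0 \/ i = t1) /\ x = pair h i;
  ss_dist : is_func (dist M) (prod (pts M) (pts M)) (car W);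
  ss_refl : forall x, x ∈ pts M -> d M x x = zero W;
  ss_sym : forall x y, x ∈ pts M -> y ∈ pts M -> d M x y = d M y x;
  ss_ultra : forall x y z e, x ∈ pts M -> y ∈ pts M -> z ∈ pts M ->
    wle W (d M x y) e -> wle W (d M y z) e -> wle W (d M x z) e;
  ss_func : is_func f (pts M) (pts M);
  ss_swap0 : forall h, h ∈ N -> app f (pair h t0) = pair h t1;
  ss_swap1 : forall h, h ∈ N -> app f (pair h t1) = pair h t0;
  ss_isom : forall x y, x ∈ pts M -> y ∈ pts M ->
    d M (app f x) (app f y) = d M x y;
  ss_seq : forall h, h ∈ N -> is_func h w (wpos W);
  ss_agree : forall h h' i i' n, h ∈ N -> h' ∈ N ->
    pair h i ∈ pts M -> pair h' i' ∈ pts M -> n ∈ w ->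
    (forall k, k ∈ w -> upto k n -> app h k = app h' k) ->
    wle W (d M (pair h i) (pair h' i')) (app h n);
  ss_const : forall r, r ∈ wpos W ->
    exists h, h ∈ N /\ forall k, k ∈ w -> app h k = r;
  ss_update : forall h n r, h ∈ N -> n ∈ w -> r ∈ wpos W ->
    exists h', h' ∈ N /\ app h' n = r /\
      forall k, k ∈ w -> k <> n -> app h' k = app h k }.

Section Construction.
Context {X : membership} (HX : ZFC X) (W : monoid_data X).
Context (OM : ordered_monoid W) (HC : continuous_at_0 W) (HW : complete W).
Context (w kappa : X) (Hw : is_omega w) (Hk : is_coinit W kappa) (Hwk : w ∈ kappa).
Context (t0 t1 : X) (Ht : t0 <> t1).
Implicit Types (a b c f g h p q r s t u v x y z A B k m n i j : X).

Lemma class_inf (P : X -> Prop) : definable (fun e => P (e 0)) ->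
  (forall x, P x -> x ∈ car W) -> exists x, is_inf W P x.
Proof.
  intros D S; set (A := sep (car W) P).
  assert (HA : forall x, x ∈ A <-> x ∈ car W /\ P x) by (apply in_sep; assumption).
  destruct (@HW A) as [(x & Hx & L & G) _]; [intros x; rewrite HA; tauto|].
  exists x; split; [exact Hx|]; split.
  - intros a Ha; apply L, HA; auto.
  - intros y Hy H; apply G; [exact Hy|]; intros a Ha; apply H; apply HA in Ha; tauto.
Qed.

Lemma finite_lower_bound h : is_func h w (wpos W) ->
  forall n, n ∈ w -> exists e, e ∈ wpos W /\
    forall k, k ∈ w -> upto k n -> wle W e (app h k).
Proof.
  intros Hh.
  assert (V : forall k, k ∈ w -> app h k ∈ wpos W) by (intros k; apply (app_in HX Hh)).
  refine (omega_ind HX Hw (P := fun n => exists e, e ∈ wpos W /\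
    forall k, k ∈ w -> upto k n -> wle W e (app h k)) _ _ _).
  - pose proof (fun x y y' => func_fun HX (x:=x) (y:=y) (y':=y') Hh).
    unfold upto; definability.
  - intros n Hn Z; exists (app h n); split; [auto|]; intros k Hkw [K| ->].
    + destruct (Z _ K).
    + apply wle_refl; auto; eapply wpos_car; eauto.
  - intros m n Hm Hn S (e & He & L).
    destruct (wpos_min HX OM He (V n Hn)) as (e' & He' & L1 & L2).
    exists e'; split; [exact He'|]; intros k Hkw [K| ->]; [|exact L2].
    eapply wle_trans; [eassumption|exact L1|]; apply L; [exact Hkw|].
    apply S in K; exact K.
Qed.

(** Otherwise the running infima of [h], which are positive by
    [finite_lower_bound], would form an initial sequence of length [w],
    contradicting the minimality of [kappa]. *)
Lemma seq_lower_bound h : is_func h w (wpos W) ->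
  exists e, e ∈ wpos W /\ forall n, n ∈ w -> wle W e (app h n).
Proof.
  intros Hh; apply NNPP; intros N.
  assert (V : forall k, k ∈ w -> app h k ∈ wpos W) by (intros k; apply (app_in HX Hh)).
  assert (U : forall x y y', pair x y ∈ h -> pair x y' ∈ h -> y = y')
    by (exact (fun x y y' => func_fun HX Hh)).
  (* the running infimum of [h] *)
  set (R := fun n z =>
    is_inf W (fun y => exists k, k ∈ w /\ upto k n /\ y = app h k) z).
  destruct (@func_exists X HX w (wpos W) R) as (v & Hv & Rv).
  - unfold R, upto; definability.
  - intros n Hn; destruct (@class_inf (fun y => exists k, k ∈ w /\ upto k n /\ y = app h k))
      as (z & Hz).
    + unfold upto; definability.
    + intros x (k & Hkw & _ & ->); eapply wpos_car; eauto.
    + exists z; split; [|exact Hz].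
      destruct (finite_lower_bound Hh Hn) as (e & He & L).
      apply (wpos_up HX OM He); apply Hz; [eapply wpos_car; eauto|].
      intros a (k & Hkw & K & ->); auto.
  - intros n y y' _ H1 H2; eapply (is_inf_unique (wle_antisym OM)); eauto.
  - apply (proj2 Hk w Hwk); exists v; split; [apply Hw|]; split; [exact Hv|]; split.
    + intros i j Hi Hj Hij; apply (Rv i Hi); [apply (Rv j Hj)|].
      intros a (k & Hkw & K & ->); apply (Rv j Hj); exists k; repeat split; auto.
      destruct Hij as [Hij| ->]; [|exact K]; left; destruct K as [K| ->]; auto.
      exact (omega_mem_trans Hw Hj K Hij).
    + intros x Hx; apply NNPP; intros M; apply N; exists x; split; [exact Hx|].
      intros n Hn; apply NNPP; intros L; apply M; exists n; split; [exact Hn|].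
      eapply wle_trans; [eassumption| |apply not_wle; try eassumption].
      * apply (Rv n Hn); exists n; repeat split; auto; right; reflexivity.
      * eapply wpos_car; eauto.
      * eapply wpos_car; eauto.
Qed.

Definition seqs : X :=
  sep (power (prod w (wpos W))) (fun h => is_func h w (wpos W)).

Lemma in_seqs h : h ∈ seqs <-> is_func h w (wpos W).
Proof.
  unfold seqs; rewrite in_sep; [|assumption|definability].
  split; [tauto|]; intros H; split; [|exact H]; now apply func_power.
Qed.

Lemma seq_app_pos h n : h ∈ seqs -> n ∈ w -> app h n ∈ wpos W.
Proof. intros H; apply in_seqs in H; apply (app_in HX H). Qed.

Lemma seq_app_car h n : h ∈ seqs -> n ∈ w -> app h n ∈ car W.
Proof. intros H Hn; eapply wpos_car; eauto using seq_app_pos. Qed.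

Definition points : X := prod seqs (upair t0 t1).

Lemma in_points x : x ∈ points <->
  exists h i, h ∈ seqs /\ (i = t0 \/ i = t1) /\ x = pair h i.
Proof.
  unfold points; rewrite in_prod by assumption.
  split; intros (h & i & Hh & Hi & E); exists h, i; rewrite in_upair in * by assumption; auto.
Qed.

Lemma in_points_pair h i : pair h i ∈ points <-> h ∈ seqs /\ (i = t0 \/ i = t1).
Proof. unfold points; rewrite in_prod_pair, in_upair by assumption; tauto. Qed.

Definition agree h h' n : Prop :=
  forall k, k ∈ w -> upto k n -> app h k = app h' k.

Lemma agree_sym h h' n : agree h h' n -> agree h' h n.
Proof. intros H k K1 K2; symmetry; auto. Qed.

Lemma agree_trans h h' h'' n : agree h h' n -> agree h' h'' n -> agree h h'' n.
Proof. intros H H' k K1 K2; rewrite H; auto. Qed.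

Lemma agree_upto h h' n m : n ∈ w -> upto m n -> agree h h' n -> agree h h' m.
Proof.
  intros Hn Hm H k Hkw K; apply H; [exact Hkw|].
  destruct Hm as [Hm| ->]; [|exact K]; left; destruct K as [K| ->]; [|exact Hm].
  exact (omega_mem_trans Hw Hn K Hm).
Qed.

Lemma agree_top h h' n : n ∈ w -> agree h h' n -> app h n = app h' n.
Proof. intros Hn H; apply H; [exact Hn|now right]. Qed.

(** The values whose infimum is the distance between distinct points over [h]
    and [h']. *)
Definition radius h h' z : Prop :=
  exists n, n ∈ w /\ agree h h' n /\ z = app h n.

Definition dist_rel x y z : Prop :=
  (x = y /\ z = zero W) \/
  (x <> y /\ exists h i h' i', h ∈ seqs /\ h' ∈ seqs /\ x = pair h i /\ y = pair h' i' /\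
     is_inf W (radius h h') z).

(** The infimum exists because the ground model regards [W] as complete. *)
Lemma dist_exists : exists D, is_func D (prod points points) (car W) /\
  forall x y, x ∈ points -> y ∈ points -> dist_rel x y (app2 D x y).
Proof.
  set (R := fun t z => exists x y, t = pair x y /\ dist_rel x y z).
  destruct (@func_exists X HX (prod points points) (car W) R) as (D & HD & RD).
  - apply definable_ext with (fun e => exists x y, e 0 = pair x y /\
     ((x = y /\ e 1 = zero W) \/
      (x <> y /\ exists h i h' i', h ∈ seqs /\ h' ∈ seqs /\
        x = pair h i /\ y = pair h' i' /\
      is_inf W (fun z => exists n, n ∈ w /\ 
        (forall k, k ∈ w -> upto k n -> uapp h k = uapp h' k) /\ z = uapp h n) (e 1)))).
    + assert (Q : forall h h' z, h ∈ seqs -> h' ∈ seqs -> radius h h' z <->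
        exists n, n ∈ w /\ 
        (forall k, k ∈ w -> upto k n -> uapp h k = uapp h' k) /\ z = uapp h n).
      { intros h h' z Hh Hh'; apply in_seqs in Hh; apply in_seqs in Hh'.
        assert (forall k, k ∈ w -> app h k = uapp h k) as E by (intros k; apply (app_uapp HX Hh)).
        assert (forall k, k ∈ w -> app h' k = uapp h' k) as E' by (intros k; apply (app_uapp HX Hh')).
        split; intros (n & Hn & A1 & A2); exists n; (split; [exact Hn|split]);
          try (intros k K1 K2; specialize (A1 k K1 K2)); 
          rewrite ?E, ?E' in *; auto. }
      intros e; split; intros (x & y & E & [H|(Nxy & h & i & h' & i' & Hh & Hh' & E1 & E2 & I)]);
        exists x, y; (split; [exact E|]); [now left|right|now left|right];
        (split; [exact Nxy|]); exists h, i, h', i'; do 4 (split; [assumption|]);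
        (split; [apply I|split]).
      * intros a Ha; apply I, Q; assumption.
      * intros z Hz L; apply I; [exact Hz|]; intros a Ha; apply L; apply Q; assumption.
      * intros a Ha; apply I, Q; assumption.
      * intros z Hz L; apply I; [exact Hz|]; intros a Ha; apply L; apply Q; assumption.
    + unfold upto; definability.
  - intros t Ht'; apply in_prod in Ht'; [|assumption].
    destruct Ht' as (x & y & Hx & Hy & ->).
    destruct (classic (x = y)) as [Exy|Nxy].
    + exists (zero W); split; [apply zero_car; assumption|].
      exists x, y; split; [reflexivity|now left].
    + apply in_points in Hx; destruct Hx as (h & i & Hh & Hi & E1).
      apply in_points in Hy; destruct Hy as (h' & i' & Hh' & Hi' & E2).
      destruct (@class_inf (radius h h')) as (z & Hz).
      * unfold radius, agree, upto.
        pose proof (fun x y y' => func_fun HX (x:=x) (y:=y) (y':=y') (proj1 (in_seqs h) Hh)).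
        pose proof (fun x y y' => func_fun HX (x:=x) (y:=y) (y':=y') (proj1 (in_seqs h') Hh')).
        definability.
      * intros r (n & Hn & _ & ->); now apply seq_app_car.
      * exists z; split; [apply Hz|]; exists x, y; split; [reflexivity|].
        right; split; [exact Nxy|]; exists h, i, h', i'; auto.
  - intros t z z' _ (x & y & -> & H) (x' & y' & E & H').
    apply (pair_inj HX) in E; destruct E; subst x' y'.
    destruct H as [[E1 E2]|(N & h & i & h' & i' & _ & _ & E1 & E2 & I)],
       H' as [[E1' E2']|(N' & g & j & g' & j' & _ & _ & E1' & E2' & I')]; try congruence.
    rewrite E1 in E1'; rewrite E2 in E2'.
    apply (pair_inj HX) in E1'; apply (pair_inj HX) in E2'.
    destruct E1', E2'; subst; eapply (is_inf_unique (wle_antisym OM)); eauto.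
  - exists D; split; [exact HD|]; intros x y Hx Hy.
    destruct (RD (pair x y)) as (x' & y' & E & H); [now apply in_prod_pair|].
    apply (pair_inj HX) in E; destruct E; subst; exact H.
Qed.

Context (D : X).
Context (HD : is_func D (prod (points) (points)) (car W)).
Context (RD : forall x y, x ∈ points -> y ∈ points -> dist_rel x y (app2 D x y)).

Let M : space X := Space points D.

Lemma d_car x y : x ∈ points -> y ∈ points -> d M x y ∈ car W.
Proof. intros Hx Hy; apply (app_in HX HD); now apply in_prod_pair. Qed.

Lemma d_refl x : x ∈ points -> d M x x = zero W.
Proof. intros Hx; destruct (RD Hx Hx) as [H|H]; tauto. Qed.

Lemma d_inf h i h' i' : pair h i ∈ points -> pair h' i' ∈ points ->
  pair h i <> pair h' i' -> is_inf W (radius h h') (d M (pair h i) (pair h' i')).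
Proof.
  intros Hx Hy N; destruct (RD Hx Hy) as [[E _]|(_ & g & j & g' & j' & _ & _ & E & E' & I)].
  - tauto.
  - apply (pair_inj HX) in E; apply (pair_inj HX) in E'.
    destruct E, E'; subst; exact I.
Qed.

Lemma d_sym x y : x ∈ points -> y ∈ points -> d M x y = d M y x.
Proof.
  intros Hx Hy; destruct (classic (x = y)) as [E|N]; [now subst|].
  pose proof Hx as Hx'; apply in_points in Hx'; destruct Hx' as (h & i & Hh & Hi & ->).
  pose proof Hy as Hy'; apply in_points in Hy'; destruct Hy' as (h' & i' & Hh' & Hi' & ->).
  apply (is_inf_unique (wle_antisym OM) (P := radius h h')); [now apply d_inf|].
  replace (radius h h') with (radius h' h); [apply d_inf; auto|].
  apply functional_extensionality; intros z; apply propositional_extensionality.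
  split; intros (n & Hn & A & ->); exists n;
    rewrite (agree_top Hn A); auto using agree_sym.
Qed.

Lemma d_agree h h' i i' n : pair h i ∈ points -> pair h' i' ∈ points -> n ∈ w ->
  agree h h' n -> wle W (d M (pair h i) (pair h' i')) (app h n).
Proof.
  intros Hx Hy Hn A; pose proof Hx as Hh; apply in_points_pair in Hh.
  destruct (classic (pair h i = pair h' i')) as [<-|N].
  - rewrite d_refl by assumption; apply zero_wle; [assumption|]; apply seq_app_car; tauto.
  - apply (d_inf Hx Hy N); exists n; auto.
Qed.

Lemma d_not_ge h i h' i' r : pair h i ∈ points -> pair h' i' ∈ points ->
  pair h i <> pair h' i' -> r ∈ car W -> ~ wle W r (d M (pair h i) (pair h' i')) ->
  exists n, n ∈ w /\ agree h h' n /\ ~ wle W r (app h n).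
Proof.
  intros Hx Hy N Hr L; apply NNPP; intros E; apply L, (d_inf Hx Hy N); [exact Hr|].
  intros a (n & Hn & A & ->); apply NNPP; intros L'; apply E; eauto.
Qed.

(** If the distance [r] from [x] to [z] exceeded both other distances, there
    would be agreement from [x] to [y] and from [y] to [z] up to indices where
    the sequences drop below [r]; at the smaller index there is agreement from
    [x] to [z] as well, so [r] would be below that value. *)
Lemma d_ultra x y z e : x ∈ points -> y ∈ points -> z ∈ points ->
  wle W (d M x y) e -> wle W (d M y z) e -> wle W (d M x z) e.
Proof.
  intros Hx Hy Hz L1 L2.
  assert (He : e ∈ car W) by (now apply (wle_car HX OM) in L1).
  destruct (classic (x = y)) as [E|Nxy]; [now subst|].
  destruct (classic (y = z)) as [E|Nyz]; [now subst|].
  destruct (classic (x = z)) as [E|Nxz].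
  { subst z; rewrite d_refl by assumption; now apply zero_wle. }
  apply NNPP; intros L.
  pose proof (d_car Hx Hz) as Hr.
  assert (L1' : ~ wle W (d M x z) (d M x y))
    by (intros K; apply L; eapply wle_trans; eassumption).
  assert (L2' : ~ wle W (d M x z) (d M y z))
    by (intros K; apply L; eapply wle_trans; eassumption).
  set (r := d M x z) in *.
  pose proof Hx as Hx'; apply in_points in Hx'; destruct Hx' as (h & i & Hh & Hi & ->).
  pose proof Hy as Hy'; apply in_points in Hy'; destruct Hy' as (h' & i' & Hh' & Hi' & ->).
  pose proof Hz as Hz'; apply in_points in Hz'; destruct Hz' as (h'' & i'' & Hh'' & Hi'' & ->).
  destruct (d_not_ge Hx Hy Nxy Hr L1') as (n & Hn & An & Ln).
  destruct (d_not_ge Hy Hz Nyz Hr L2') as (m & Hm & Am & Lm).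
  destruct (omega_tri Hw Hn Hm) as [K|[K|K]].
  - apply Ln; apply (d_inf Hx Hz Nxz); exists n; repeat split; auto.
    eapply agree_trans; [exact An|]; eapply agree_upto; [exact Hm| |exact Am]; now left.
  - subst m; apply Ln; apply (d_inf Hx Hz Nxz); exists n; repeat split; auto.
    eapply agree_trans; eassumption.
  - apply Lm.
    assert (Anm : agree h h' m) by (eapply agree_upto; [exact Hn| |exact An]; now left).
    rewrite <- (agree_top Hm Anm).
    apply (d_inf Hx Hz Nxz); exists m; repeat split; auto.
    eapply agree_trans; eassumption.
Qed.

(** A positive lower bound of [h] bounds the distance from below. *)
Lemma d_zero x y : x ∈ points -> y ∈ points -> d M x y = zero W -> x = y.
Proof.
  intros Hx Hy E; apply NNPP; intros N.
  pose proof Hx as Hx'; apply in_points in Hx'; destruct Hx' as (h & i & Hh & Hi & ->).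
  pose proof Hy as Hy'; apply in_points in Hy'; destruct Hy' as (h' & i' & Hh' & Hi' & ->).
  destruct (seq_lower_bound (proj1 (in_seqs h) Hh)) as (e & He & L).
  assert (K : wle W e (d M (pair h i) (pair h' i'))).
  { apply (d_inf Hx Hy N); [eapply wpos_car; eauto|]; intros a (n & Hn & _ & ->); auto. }
  rewrite E in K; apply (wle_zero HX OM) in K; subst e.
  apply in_wpos in He; tauto.
Qed.

Lemma M_metric : is_metric_space W M.
Proof.
  split; [exact HD|split].
  - intros x y Hx Hy; rewrite (d_sym Hy Hx).
    replace (wmax W (d M x y) (d M x y)) with (d M x y)
      by (unfold wmax; now destruct (excluded_middle_informative _)).
    split; [now apply d_zero|]; intros ->; now apply d_refl.
  - intros x y z Hx Hy Hz; apply (@d_ultra x y z); auto.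
    + apply wle_addl; auto using d_car.
    + apply wle_addr; auto using d_car.
Qed.

Section Cauchy.
Context (p A : X) (SA : subset A (wpos W)) (Fp : is_func p A points).
Context (IA : is_inf W (fun x => exists a b, a ∈ A /\ b ∈ A /\ x = wadd W a b) (zero W)).
Context (Cp : forall a b, a ∈ A -> b ∈ A ->
  wle W (d M (app p a) (app p b)) (wadd W a b)).

Lemma cauchy_point b : b ∈ A -> exists h i, h ∈ seqs /\ pair h i ∈ points /\
  pair b (pair h i) ∈ p /\ app p b = pair h i.
Proof.
  intros Hb; pose proof (app_in HX Fp Hb) as H; pose proof (app_pair Fp Hb) as E.
  pose proof H as H'; apply in_points in H'; destruct H' as (h & i & Hh & Hi & E').
  rewrite E' in *; eauto 10.
Qed.

Lemma cauchy_small x : x ∈ wpos W -> exists b, b ∈ A /\ wle W b x.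
Proof. apply (small_radius HX OM SA IA). Qed.

(** Terms with radii at most [a] are at distance at most [a + a]. *)
Lemma cauchy_close r a b b' h i h' i' : r ∈ wpos W -> ~ wle W r (wadd W a a) ->
  b ∈ A -> b' ∈ A -> wle W b a -> wle W b' a ->
  app p b = pair h i -> app p b' = pair h' i' -> pair h i <> pair h' i' ->
  exists n, n ∈ w /\ agree h h' n /\ ~ wle W r (app h n).
Proof.
  intros Hr Na Hb Hb' L L' E E' N.
  apply (@d_not_ge h i h' i' r); [| |exact N|eapply wpos_car; eauto|].
  - rewrite <- E; exact (app_in HX Fp Hb).
  - rewrite <- E'; exact (app_in HX Fp Hb').
  - rewrite <- E, <- E'; intros K; apply Na.
    eapply wle_trans; [eassumption|exact K|].
    eapply wle_trans; [eassumption|now apply Cp|].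
    now apply wadd_mono.
Qed.

(** Phrased by membership of pairs so as to be visibly definable, which the
    induction in [stable_exists] requires. *)
Definition stable n x : Prop :=
  forall b b', b ∈ A -> b' ∈ A -> wle W b x -> wle W b' x ->
  forall h i h' i', pair b (pair h i) ∈ p -> pair b' (pair h' i') ∈ p ->
  forall u u', pair n u ∈ h -> pair n u' ∈ h' -> u = u'.

Lemma stable_app n x b b' h i h' i' : stable n x -> n ∈ w ->
  b ∈ A -> b' ∈ A -> wle W b x -> wle W b' x ->
  pair b (pair h i) ∈ p -> pair b' (pair h' i') ∈ p ->
  app h n = app h' n.
Proof.
  intros S Hn Hb Hb' L L' E E'.
  destruct (func_dom HX Fp E) as [_ Hh]; destruct (func_dom HX Fp E') as [_ Hh'].
  apply in_points_pair in Hh; apply in_points_pair in Hh'.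
  apply (S b b' Hb Hb' L L' h i h' i' E E');
    eapply (app_pair); [apply in_seqs|exact Hn|apply in_seqs|exact Hn]; tauto.
Qed.

Lemma stable_mono n x y : stable n x -> wle W y x -> stable n y.
Proof.
  intros S L b b' Hb Hb' Lb Lb'; apply S; auto; eapply wle_trans; eassumption.
Qed.

(** The values before [n] have settled, so they have a positive lower bound
    [r].  Terms at distance less than [r] must agree beyond those indices. *)
Lemma stable_step n x : n ∈ w -> x ∈ wpos W -> (forall k, k ∈ n -> stable k x) ->
  exists y, y ∈ wpos W /\ wle W y x /\ stable n y.
Proof.
  intros Hn Hx S.
  destruct (cauchy_small Hx) as (b0 & Hb0 & L0).
  destruct (cauchy_point Hb0) as (h0 & i0 & Hh0 & _ & P0 & _).
  destruct (finite_lower_bound (proj1 (in_seqs h0) Hh0) Hn) as (r & Hr & Lr).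
  destruct (wpos_half HX OM HC Hr) as (a & Ha & Na).
  destruct (wpos_min HX OM Hx Ha) as (y & Hy & Ly & La).
  exists y; split; [exact Hy|]; split; [exact Ly|].
  intros b b' Hb Hb' L L' h i h' i' P P' u u' Eu Eu'.
  destruct (func_dom HX Fp P) as [_ Hh]; destruct (func_dom HX Fp P') as [_ Hh'].
  destruct (classic (pair h i = pair h' i')) as [E|N].
  - apply (pair_inj HX) in E; destruct E; subst.
    apply in_points_pair in Hh; destruct Hh as [Hh _]; apply in_seqs in Hh.
    eapply (func_fun HX Hh); eassumption.
  - destruct (@cauchy_close r a b b' h i h' i') as (m & Hm & Am & Lm);
      try assumption; try (eapply wle_trans; eassumption);
      try (eapply (app_eq HX Fp); eassumption).
    apply in_points_pair in Hh; destruct Hh as [Hh _].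
    apply in_points_pair in Hh'; destruct Hh' as [Hh' _].
    (* the index [m] of agreement cannot lie before [n], where [r] is a lower bound *)
    assert (K : upto n m).
    { destruct (omega_tri Hw Hm Hn) as [K|[K|K]].
      - exfalso; apply Lm. rewrite (@stable_app m x b b0 h i h0 i0); try assumption.
        + apply Lr; [exact Hm|now left].
        + now apply S.
        + eapply wle_trans; eassumption.
      - right; congruence.
      - now left. }
    specialize (Am n Hn K).
    rewrite (app_eq HX (proj1 (in_seqs h) Hh) Eu) in Am.
    rewrite (app_eq HX (proj1 (in_seqs h') Hh') Eu') in Am; exact Am.
Qed.

Lemma stable_exists n : n ∈ w ->
  exists x, x ∈ wpos W /\ forall k, upto k n -> stable k x.
Proof.
  revert n; refine (omega_ind HX Hw (P := fun n => exists x, x ∈ wpos W /\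
    forall k, upto k n -> stable k x) _ _ _).
  - unfold upto, stable; definability.
  - intros n Hn Z.
    destruct Hk as [(s & _ & Fs & _) _]; pose proof (app_in HX Fs Hwk) as Hx.
    destruct (stable_step Hn Hx) as (y & Hy & _ & S).
    + intros k Hkn; destruct (Z _ Hkn).
    + exists y; split; [exact Hy|]; intros k [K| ->]; [destruct (Z _ K)|exact S].
  - intros m n Hm Hn Sn (x & Hx & S).
    destruct (stable_step Hn Hx) as (y & Hy & L & S').
    + intros k Hkn; apply S, Sn, Hkn.
    + exists y; split; [exact Hy|]; intros k [K| ->]; [|exact S'].
      apply stable_mono with x; [apply S, Sn, K|exact L].
Qed.

(** The limit is a function in the model because the eventual value at [n] is
    definable from the Cauchy sequence. *)
Lemma limit_exists : exists u, is_func u w (wpos W) /\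
  forall n, n ∈ w -> exists x, x ∈ wpos W /\
    forall b h i, b ∈ A -> wle W b x -> pair b (pair h i) ∈ p -> app h n = app u n.
Proof.
  set (R := fun n v => exists x, x ∈ wpos W /\
    forall b h i, b ∈ A -> wle W b x -> pair b (pair h i) ∈ p -> pair n v ∈ h).
  destruct (@func_exists X HX w (wpos W) R) as (u & Hu & Ru).
  - unfold R; definability.
  - intros n Hn; destruct (stable_exists Hn) as (x & Hx & S).
    destruct (cauchy_small Hx) as (b & Hb & L).
    destruct (cauchy_point Hb) as (h & i & Hh & _ & P & _).
    exists (app h n); split; [now apply seq_app_pos|].
    exists x; split; [exact Hx|]; intros b' h' i' Hb' L' P'.
    assert (S' : stable n x) by (apply S; now right).
    rewrite (@stable_app n x b b' h i h' i'); try assumption.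
    eapply (app_pair); [apply in_seqs|exact Hn].
    destruct (func_dom HX Fp P') as [_ Hh']; apply in_points_pair in Hh'; tauto.
  - intros n v v' Hn (x & Hx & H) (x' & Hx' & H').
    destruct (wpos_min HX OM Hx Hx') as (y & Hy & L & L').
    destruct (cauchy_small Hy) as (b & Hb & Lb).
    destruct (cauchy_point Hb) as (h & i & Hh & _ & P & _).
    apply in_seqs in Hh; apply (func_fun HX Hh (x := n)).
    + apply (H b h i); try assumption; eapply wle_trans; eassumption.
    + apply (H' b h i); try assumption; eapply wle_trans; eassumption.
  - exists u; split; [exact Hu|]; intros n Hn.
    destruct (Ru n Hn) as (x & Hx & H); exists x; split; [exact Hx|].
    intros b h i Hb L P; destruct (func_dom HX Fp P) as [_ Hh].
    apply in_points_pair in Hh; destruct Hh as [Hh _]; apply in_seqs in Hh.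
    apply (app_eq HX Hh); eauto.
Qed.

Lemma limit_upto u : is_func u w (wpos W) ->
  (forall n, n ∈ w -> exists x, x ∈ wpos W /\
    forall b h i, b ∈ A -> wle W b x -> pair b (pair h i) ∈ p -> app h n = app u n) ->
  forall n, n ∈ w -> exists x, x ∈ wpos W /\
    forall b h i, b ∈ A -> wle W b x -> pair b (pair h i) ∈ p -> agree h u n.
Proof.
  intros Hu H n Hn; destruct (stable_exists Hn) as (x & Hx & S).
  exists x; split; [exact Hx|]; intros b h i Hb L P k Hkw K.
  destruct (H k Hkw) as (y & Hy & Hky).
  destruct (wpos_min HX OM Hx Hy) as (z & Hz & L1 & L2).
  destruct (cauchy_small Hz) as (b' & Hb' & L').
  destruct (cauchy_point Hb') as (h' & i' & Hh' & _ & P' & _).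
  rewrite (@stable_app k x b b' h i h' i'); auto.
  - apply (Hky b' h' i'); try assumption; eapply wle_trans; eassumption.
  - eapply wle_trans; eassumption.
Qed.

(** Let [r] be a positive lower bound of the limit [u].  Distinct terms with
    small radii have distance below [r], hence agree up to an index [j] where
    their common value is below [r].  A third term that follows [u] up to [j]
    is either equal to the first term or agrees with it up to such an index
    too, and either way [u] takes a value below [r]. *)
Lemma eventually_constant : exists x a, x ∈ points /\ a ∈ wpos W /\
  forall b, b ∈ A -> wle W b a -> app p b = x.
Proof.
  destruct limit_exists as (u & Hu & H); pose proof (limit_upto Hu H) as H'.
  destruct (seq_lower_bound Hu) as (r & Hr & Lr).
  destruct (wpos_half HX OM HC Hr) as (a & Ha & Na).
  destruct (cauchy_small Ha) as (b0 & Hb0 & L0).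
  exists (app p b0), a; split; [exact (app_in HX Fp Hb0)|]; split; [exact Ha|].
  intros b Hb L.
  destruct (cauchy_point Hb) as (h & i & Hh & _ & P & E).
  destruct (cauchy_point Hb0) as (h0 & i0 & Hh0 & _ & P0 & E0).
  rewrite E, E0; apply NNPP; intros N.
  destruct (@cauchy_close r a b b0 h i h0 i0) as (j & Hj & Aj & Lj); try assumption.
  destruct (H' j Hj) as (x & Hx & Ax).
  destruct (wpos_min HX OM Hx Ha) as (y & Hy & Lx & La).
  destruct (cauchy_small Hy) as (b1 & Hb1 & L1).
  destruct (cauchy_point Hb1) as (h1 & i1 & Hh1 & _ & P1 & E1).
  assert (A1 : agree h1 u j)
    by (apply (Ax b1 h1 i1); try assumption; eapply wle_trans; eassumption).
  assert (F : forall k, k ∈ w -> upto k j -> ~ wle W r (app h1 k) -> False).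
  { intros k Hkw K Nk; apply Nk; rewrite (A1 k Hkw K); auto. }
  destruct (classic (pair h i = pair h1 i1)) as [Eq|N1].
  { apply (pair_inj HX) in Eq; destruct Eq; subst; apply (F j); auto; now right. }
  destruct (@cauchy_close r a b b1 h i h1 i1) as (k & Hkw & Ak & Lk);
    try assumption; [eapply wle_trans; eassumption|].
  destruct (omega_tri Hw Hkw Hj) as [K|[K|K]].
  - apply (F k Hkw); [now left|]; rewrite <- (agree_top Hkw Ak); exact Lk.
  - apply (F k Hkw); [now right|]; rewrite <- (agree_top Hkw Ak); exact Lk.
  - apply (F j Hj); [now right|]; rewrite <- (Ak j Hj); [exact Lj|now left].
Qed.

(** Convergence in the two directions is proved by one argument, with the
    arguments of the distance exchanged. *)
Lemma cauchy_limit : exists x, x ∈ points /\ converges W M p x.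
Proof.
  destruct eventually_constant as (x & a & Hx & Ha & E); exists x; split; [exact Hx|].
  assert (G : forall D' : X -> X -> X, (forall b, b ∈ A -> D' x (app p b) ∈ car W) ->
    D' x x = zero W ->
    wsup W (fun y => exists c, c ∈ wpos W /\
      y = winf W (fun z => exists b, in_dom p b /\ wle W b c /\
                         z = D' x (app p b))) = zero W).
  { intros D' C R.
    assert (Z : forall c, c ∈ wpos W -> winf W (fun z => exists b, in_dom p b /\
      wle W b c /\ z = D' x (app p b)) = zero W).
    { intros c Hc; apply (winf_eq (wle_antisym OM)); split; [now apply zero_car|]; split.
      - intros z (b & (y & Hb) & _ & ->); apply zero_wle; [assumption|].
        apply C; now apply (func_dom HX Fp) in Hb.
      - intros y Hy L; destruct (wpos_min HX OM Hc Ha) as (c' & Hc' & L1 & L2).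
        destruct (cauchy_small Hc') as (b & Hb & Lb).
        rewrite <- R; apply L; exists b; split; [|split].
        + exists (app p b); exact (app_pair Fp Hb).
        + eapply wle_trans; eassumption.
        + rewrite E; [reflexivity|exact Hb|eapply wle_trans; eassumption]. }
    apply (wsup_eq (wle_antisym OM)); split; [now apply zero_car|]; split.
    - intros y (c & Hc & ->); rewrite Z by assumption.
      apply wle_refl; auto; now apply zero_car.
    - intros y Hy _; now apply zero_wle. }
  split.
  - apply (G (d M)); [|now apply d_refl].
    intros b Hb; apply d_car; [exact Hx|exact (app_in HX Fp Hb)].
  - apply (G (fun x y => d M y x)); [|now apply d_refl].
    intros b Hb; apply d_car; [exact (app_in HX Fp Hb)|exact Hx].
Qed.

End Cauchy.

Lemma M_complete : cauchy_complete W M.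
Proof.
  split; [exact HW|]; intros p (A & SA & Fp & IA & Cp).
  exact (cauchy_limit SA Fp IA Cp).
Qed.

Lemma swap_exists : exists f, is_func f points points /\ forall h, h ∈ seqs ->
  app f (pair h t0) = pair h t1 /\ app f (pair h t1) = pair h t0.
Proof.
  set (R := fun x y => exists h,
    (x = pair h t0 /\ y = pair h t1) \/ (x = pair h t1 /\ y = pair h t0)).
  assert (U : forall x y y', R x y -> R x y' -> y = y').
  { intros x y y' (h & [[E1 E2]|[E1 E2]]) (h' & [[E1' E2']|[E1' E2']]); subst;
      apply (pair_inj HX) in E1'; destruct E1'; subst; congruence. }
  destruct (@func_exists X HX points points R) as (f & Ff & Rf).
  - unfold R; definability.
  - intros x Hx; apply in_points in Hx; destruct Hx as (h & i & Hh & [-> | ->] & ->).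
    + exists (pair h t1); rewrite in_points_pair; unfold R; eauto 8.
    + exists (pair h t0); rewrite in_points_pair; unfold R; eauto 8.
  - intros x y y' _; apply U.
  - exists f; split; [exact Ff|]; intros h Hh; split;
      (eapply U; [apply Rf; apply in_points_pair; auto|exists h; auto]).
Qed.

Section Swap.
Context (f : X) (Ff : is_func f points points).
Context (Sf : forall h, h ∈ seqs ->
  app f (pair h t0) = pair h t1 /\ app f (pair h t1) = pair h t0).

Lemma swap_point h i : pair h i ∈ points ->
  exists j, app f (pair h i) = pair h j /\ pair h j ∈ points /\ i <> j /\
    app f (pair h j) = pair h i.
Proof.
  rewrite in_points_pair; intros [Hh [-> | ->]]; destruct (Sf Hh) as [S0 S1].
  - exists t1; rewrite in_points_pair; auto 8.
  - exists t0; rewrite in_points_pair; auto 8.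
Qed.

Lemma swap_isom x y : x ∈ points -> y ∈ points -> d M (app f x) (app f y) = d M x y.
Proof.
  intros Hx Hy; destruct (classic (x = y)) as [E|N].
  { subst y; rewrite !d_refl; auto; exact (app_in HX Ff Hx). }
  pose proof Hx as Hx'; apply in_points in Hx'; destruct Hx' as (h & i & Hh & Hi & ->).
  pose proof Hy as Hy'; apply in_points in Hy'; destruct Hy' as (h' & i' & Hh' & Hi' & ->).
  destruct (swap_point Hx) as (j & E & P & _ & I).
  destruct (swap_point Hy) as (j' & E' & P' & _ & I').
  rewrite E, E'; apply (is_inf_unique (wle_antisym OM) (P := radius h h')); apply d_inf; auto.
  intros K; apply N; rewrite <- I, <- I', K; reflexivity.
Qed.

Lemma swap_no_fixed_point : ~ has_fixed_point M f.
Proof.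
  intros (x & Hx & E); pose proof Hx as Hx'; apply in_points in Hx'.
  destruct Hx' as (h & i & Hh & Hi & ->).
  destruct (swap_point Hx) as (j & E' & _ & N & _).
  rewrite E in E'; apply (pair_inj HX) in E'; tauto.
Qed.

Lemma seqs_const r : r ∈ wpos W ->
  exists h, h ∈ seqs /\ forall k, k ∈ w -> app h k = r.
Proof.
  intros Hr; destruct (@func_exists X HX w (wpos W) (fun _ y => y = r)) as (h & Fh & Rh).
  - definability.
  - eauto.
  - congruence.
  - exists h; split; [now apply in_seqs|exact Rh].
Qed.

Lemma seqs_update h n r : h ∈ seqs -> n ∈ w -> r ∈ wpos W ->
  exists h', h' ∈ seqs /\ app h' n = r /\
    forall k, k ∈ w -> k <> n -> app h' k = app h k.
Proof.
  intros Hh Hn Hr; apply in_seqs in Hh.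
  destruct (@func_exists X HX w (wpos W)
    (fun k y => (k = n /\ y = r) \/ (k <> n /\ pair k y ∈ h))) as (h' & Fh & Rh).
  - definability.
  - intros k Hkw; destruct (classic (k = n)); [eauto|].
    exists (app h k); split; [exact (app_in HX Hh Hkw)|right; split; [assumption|]].
    exact (app_pair Hh Hkw).
  - intros k y y' _ [[? ?]|[? E]] [[? ?]|[? E']]; try congruence.
    exact (func_fun HX Hh E E').
  - exists h'; split; [now apply in_seqs|]; split.
    + destruct (Rh n Hn); tauto.
    + intros k Hkw N; destruct (Rh k Hkw) as [|[_ E]]; [tauto|].
      symmetry; exact (app_eq HX Hh E).
Qed.

Lemma M_system : shift_system W M f seqs w t0 t1.
Proof.
  split.
  - exact in_points.
  - exact HD.
  - exact d_refl.
  - exact d_sym.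
  - exact d_ultra.
  - exact Ff.
  - intros h Hh; apply Sf; exact Hh.
  - intros h Hh; apply Sf; exact Hh.
  - exact swap_isom.
  - intros h; apply in_seqs.
  - intros h h' i i' n _ _ Hx Hy Hn A; exact (d_agree Hx Hy Hn A).
  - exact seqs_const.
  - exact seqs_update.
Qed.

End Swap.
End Construction.

Lemma construction (X : membership) (HX : ZFC X) (W : monoid_data X)
  (HW : is_distance_monoid W) (HWc : continuous W) (w kappa t0 t1 : X) :
  is_omega w -> is_coinit W kappa -> w ∈ kappa -> t0 <> t1 ->
  exists M f N, shift_system W M f N w t0 t1 /\ is_dynamical_system W M f /\
    ~ has_fixed_point M f.
Proof.
  intros Hw Hk Hwk Ht; destruct HWc as [HC H0].
  pose proof (distance_monoid_ordered HW) as OM.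
  destruct (dist_exists HX OM HC w t0 t1) as (D & HD & RD).
  destruct (@swap_exists X HX W w t0 t1) as (f & Ff & Sf); try exact Ht.
  assert (S : shift_system W (Space (points W w t0 t1) D) f (seqs W w) w t0 t1)
    by (eapply M_system; eassumption).
  exists (Space (points W w t0 t1) D), f, (seqs W w); split; [exact S|]; split.
  - split; [exact HW|]; split; [exact HC|]; split; [|split].
    + eapply M_metric; eassumption.
    + eapply M_complete; eassumption.
    + split; [exact Ff|]; intros x y Hx Hy; rewrite (ss_isom S Hx Hy).
      apply wle_refl; [exact OM|]; eapply d_car; eassumption.
  - eapply swap_no_fixed_point; eassumption.
Qed.

(** * Absoluteness along a transitive inclusion *)

Section Transfer.
Context {X Y : membership} (HX : ZFC X) (HY : ZFC Y) (io : X -> Y).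
Context (io_mem : forall x y : X, io x ∈ io y <-> x ∈ y).
Context (io_surj : forall (a : X) (y : Y), y ∈ io a -> exists x, x ∈ a /\ y = io x).
Implicit Types (a b c f x y z w s t : X).

Lemma io_inj x y : io x = io y -> x = y.
Proof. intros E; apply (set_ext HX); intros z; rewrite <- !io_mem, E; tauto. Qed.

Lemma io_ext a (b : Y) : (forall x, x ∈ a -> io x ∈ b) ->
  (forall y : Y, y ∈ b -> exists x, x ∈ a /\ y = io x) -> io a = b.
Proof.
  intros H1 H2; apply (set_ext HY); intros y; split; intros Hy.
  - apply io_surj in Hy; destruct Hy as (x & Hx & ->); auto.
  - apply H2 in Hy; destruct Hy as (x & Hx & ->); now apply io_mem.
Qed.

Lemma io_upair a b : io (upair a b) = upair (io a) (io b).
Proof.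
  apply io_ext.
  - intros x; rewrite !in_upair by assumption; intros [-> | ->]; auto.
  - intros y; rewrite in_upair by assumption; intros [-> | ->]; eexists;
      rewrite in_upair by assumption; eauto.
Qed.

Lemma io_pair a b : io (pair a b) = pair (io a) (io b).
Proof. unfold pair; now rewrite !io_upair. Qed.

Lemma io_prod a b : io (prod a b) = prod (io a) (io b).
Proof.
  apply io_ext.
  - intros t Ht; apply in_prod in Ht; [|assumption].
    destruct Ht as (x & y & Hx & Hy & ->); rewrite io_pair.
    apply in_prod_pair; [assumption|]; now rewrite !io_mem.
  - intros y Hy; apply in_prod in Hy; [|assumption].
    destruct Hy as (u & v & Hu & Hv & ->).
    apply io_surj in Hu; destruct Hu as (x & Hx & ->).
    apply io_surj in Hv; destruct Hv as (z & Hz & ->).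
    exists (pair x z); rewrite io_pair, in_prod_pair by assumption; auto.
Qed.

(** The right-hand side quantifies over more elements [y], but the values of
    [f] already lie in the smaller model. *)
Lemma io_func f a b : is_func f a b -> is_func (io f) (io a) (io b).
Proof.
  intros F; split.
  - intros t Ht; apply io_surj in Ht; destruct Ht as (u & Hu & ->).
    destruct (proj1 F u Hu) as (x & y & Hx & Hy & ->).
    exists (io x), (io y); rewrite io_pair, !io_mem; auto.
  - intros u Hu; apply io_surj in Hu; destruct Hu as (x & Hx & ->).
    exists (io (app f x)); split.
    + rewrite <- io_pair; apply io_mem; exact (app_pair F Hx).
    + intros v Hv; pose proof (io_surj Hv) as (t & Ht & E).
      destruct (proj1 F t Ht) as (x' & y' & Hx' & Hy' & ->).
      rewrite io_pair in E; apply (pair_inj HY) in E; destruct E as [E ->].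
      apply io_inj in E; subst x'; now rewrite (app_eq HX F Ht).
Qed.

Lemma io_app f a b x : is_func f a b -> x ∈ a -> app (io f) (io x) = io (app f x).
Proof.
  intros F Hx; apply (app_eq HY (io_func F)).
  rewrite <- io_pair; apply io_mem; exact (app_pair F Hx).
Qed.

(** The clause about arbitrary subsets is the one that could fail to be
    absolute; Foundation gives it in both models. *)
Lemma io_ordinal a : is_ordinal (io a) <-> is_ordinal a.
Proof.
  split; intros (H1 & H2 & H3 & _); (split; [|split; [|split]]).
  - intros x y Hx Hy; rewrite <- io_mem; apply (H1 (io x)); now apply io_mem.
  - intros x y z Hx Hy Hz Hxy Hyz; rewrite <- io_mem; apply (H2 (io x) (io y)); now apply io_mem.
  - intros x y Hx Hy; rewrite <- !io_mem.
    destruct (H3 (io x) (io y)) as [H|[H|H]]; try (now apply io_mem); auto.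
    apply io_inj in H; auto.
  - intros b _ (x & Hx); destruct (regular_el HX Hx) as (y & Hy & N).
    exists y; split; [exact Hy|]; intros z Hz Hzy; exact (N z Hzy Hz).
  - intros x y Hx Hy.
    apply io_surj in Hx; destruct Hx as (x' & Hx & ->).
    apply io_surj in Hy; destruct Hy as (y' & Hy & ->).
    apply io_mem; eauto.
  - intros x y z Hx Hy Hz.
    apply io_surj in Hx; destruct Hx as (x' & Hx & ->).
    apply io_surj in Hy; destruct Hy as (y' & Hy & ->).
    apply io_surj in Hz; destruct Hz as (z' & Hz & ->).
    rewrite !io_mem; intros; apply (H2 x' y'); auto.
  - intros x y Hx Hy.
    apply io_surj in Hx; destruct Hx as (x' & Hx & ->).
    apply io_surj in Hy; destruct Hy as (y' & Hy & ->).
    rewrite !io_mem; destruct (H3 x' y' Hx Hy) as [H|[H|H]]; subst; auto.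
  - intros b _ (x & Hx); destruct (regular_el HY Hx) as (y & Hy & N).
    exists y; split; [exact Hy|]; intros z Hz Hzy; exact (N z Hzy Hz).
Qed.

Lemma io_limit a : is_limit (io a) <-> is_limit a.
Proof.
  unfold is_limit; rewrite io_ordinal; split; intros (H1 & (x & Hx) & H2);
    (split; [exact H1|split]).
  - apply io_surj in Hx; destruct Hx as (y & Hy & _); eauto.
  - intros y Hy; destruct (H2 (io y)) as (z & Hz & Hyz); [now apply io_mem|].
    apply io_surj in Hz; destruct Hz as (z' & Hz & ->); exists z'; split; auto.
    now apply io_mem.
  - exists (io x); now apply io_mem.
  - intros y Hy; apply io_surj in Hy; destruct Hy as (y' & Hy & ->).
    destruct (H2 y' Hy) as (z & Hz & Hyz); exists (io z); now rewrite !io_mem.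
Qed.

Lemma io_omega w : is_omega w -> is_omega (io w).
Proof.
  intros [H1 H2]; split; [now apply io_limit|].
  intros x Hx; apply io_surj in Hx; destruct Hx as (y & Hy & ->).
  rewrite io_limit; auto.
Qed.

Context (W : monoid_data X) (OM : ordered_monoid W).
Notation W' := (map_monoid io W).

Lemma io_wle a b : wle W' (io a) (io b) <-> wle W a b.
Proof. unfold wle; simpl; rewrite <- io_pair; apply io_mem. Qed.

Lemma io_wadd a b : a ∈ car W -> b ∈ car W ->
  wadd W' (io a) (io b) = io (wadd W a b).
Proof.
  intros Ha Hb; unfold wadd, app2; simpl; rewrite <- io_pair.
  destruct OM as ((F & _) & _); apply (io_app F); now apply in_prod_pair.
Qed.

Lemma io_wpos : io (wpos W) = wpos W'.
Proof.
  apply io_ext.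
  - intros x; rewrite !in_wpos by assumption; simpl; rewrite io_mem.
    intros [H N]; split; [exact H|]; intros E; now apply io_inj in E.
  - intros y; rewrite in_wpos by assumption; simpl; intros [Hy N].
    apply io_surj in Hy; destruct Hy as (x & Hx & ->); exists x; split; [|reflexivity].
    apply in_wpos; [assumption|]; split; [exact Hx|]; congruence.
Qed.

Lemma io_ordered_monoid : ordered_monoid W'.
Proof.
  pose proof OM as ((F & Z & As & Co & Un) & (S & _) & _).
  split; [|split; [|split]].
  - split; [|split; [|split; [|split]]]; simpl.
    + rewrite <- io_prod; exact (io_func F).
    + now apply io_mem.
    + intros a b c Ha Hb Hc.
      apply io_surj in Ha; destruct Ha as (x & Hx & ->).
      apply io_surj in Hb; destruct Hb as (y & Hy & ->).
      apply io_surj in Hc; destruct Hc as (z & Hz & ->).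
      pose proof (wadd_car HX OM Hx Hy); pose proof (wadd_car HX OM Hy Hz).
      rewrite (io_wadd Hy Hz), (io_wadd Hx Hy), !io_wadd, As; auto.
    + intros a b Ha Hb.
      apply io_surj in Ha; destruct Ha as (x & Hx & ->).
      apply io_surj in Hb; destruct Hb as (y & Hy & ->).
      rewrite !io_wadd, Co; auto.
    + intros a Ha; apply io_surj in Ha; destruct Ha as (x & Hx & ->).
      rewrite io_wadd, Un; auto.
  - assert (D : forall a b : Y, wle W' a b -> exists x y, a = io x /\ b = io y /\ wle W x y).
    { intros a b H; destruct (io_surj H) as (t & Ht & E).
      pose proof Ht as Ht'; apply S, in_prod in Ht'; [|assumption].
      destruct Ht' as (x & y & Hx & Hy & ->); rewrite io_pair in E.
      apply (pair_inj HY) in E; destruct E; exists x, y; auto. }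
    split; [|split; [|split; [|split]]]; simpl.
    + intros t Ht; apply io_surj in Ht; destruct Ht as (u & Hu & ->).
      rewrite <- io_prod; apply io_mem; auto.
    + intros a Ha; apply io_surj in Ha; destruct Ha as (x & Hx & ->).
      apply io_wle; now apply wle_refl.
    + intros a b Hab; apply D in Hab; destruct Hab as (x & y & -> & -> & Hxy).
      rewrite io_wle; intros Hyx; now rewrite (wle_antisym OM Hxy Hyx).
    + intros a b c Hab Hbc; apply D in Hab; destruct Hab as (x & y & -> & -> & Hxy).
      apply D in Hbc; destruct Hbc as (y' & z & E & -> & Hyz).
      apply io_inj in E; subst y'; apply io_wle; now apply wle_trans with y.
    + intros a b Ha Hb.
      apply io_surj in Ha; destruct Ha as (x & Hx & ->).
      apply io_surj in Hb; destruct Hb as (y & Hy & ->).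
      rewrite !io_wle; now apply wle_total.
  - intros a Ha; apply io_surj in Ha; destruct Ha as (x & Hx & ->).
    change (zero W') with (io (zero W)); apply io_wle; now apply zero_wle.
  - intros a b c Hc H; destruct (io_surj H) as (t & Ht & E).
    pose proof Ht as Ht'; apply S, in_prod in Ht'; [|assumption].
    destruct Ht' as (x & y & Hx & Hy & ->); rewrite io_pair in E.
    apply (pair_inj HY) in E; destruct E; subst.
    apply io_surj in Hc; destruct Hc as (z & Hz & ->).
    rewrite !io_wadd, !io_wle by assumption; destruct OM as (_ & _ & _ & M); auto.
Qed.

(** The infimum is taken over sums of elements of [W], and these are the same
    in both models. *)
Lemma io_continuous : continuous_at_0 W -> continuous_at_0 W'.
Proof.
  intros (H1 & H2 & H3); split; [now apply io_mem|]; split.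
  - intros z (a & b & Ha & Hb & ->); rewrite <- io_wpos in Ha, Hb.
    apply io_surj in Ha; destruct Ha as (x & Hx & ->).
    apply io_surj in Hb; destruct Hb as (y & Hy & ->).
    rewrite io_wadd by (now apply wpos_car).
    change (zero W') with (io (zero W)); apply io_wle, H2; exists x, y; auto.
  - intros z Hz L; apply io_surj in Hz; destruct Hz as (y & Hy & ->).
    change (zero W') with (io (zero W)); apply io_wle, H3; [exact Hy|].
    intros z (a & b & Ha & Hb & ->); apply io_wle, L.
    exists (io a), (io b); rewrite <- io_wpos, !io_mem, io_wadd by (now apply wpos_car); auto.
Qed.

Context (M : space X) (f N w t0 t1 : X) (S : shift_system W M f N w t0 t1).
Notation M' := (map_space io M).

Lemma io_d x y : x ∈ pts M -> y ∈ pts M -> d M' (io x) (io y) = io (d M x y).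
Proof.
  intros Hx Hy; unfold d, app2; simpl; rewrite <- io_pair.
  apply (io_app (ss_dist S)); now apply in_prod_pair.
Qed.

Lemma io_seq_app h n : h ∈ N -> n ∈ w -> app (io h) (io n) = io (app h n).
Proof. intros Hh Hn; exact (io_app (ss_seq S Hh) Hn). Qed.

Lemma io_f x : x ∈ pts M -> app (io f) (io x) = io (app f x).
Proof. intros Hx; exact (io_app (ss_func S) Hx). Qed.

Lemma io_shift_system : shift_system W' M' (io f) (io N) (io w) (io t0) (io t1).
Proof.
  assert (P : forall h i, h ∈ N -> (i = t0 \/ i = t1) -> pair h i ∈ pts M)
    by (intros h i Hh Hi; apply (ss_pts S); eauto).
  split; simpl.
  - intros y; split.
    + intros Hy; apply io_surj in Hy; destruct Hy as (x & Hx & ->).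
      apply (ss_pts S) in Hx; destruct Hx as (h & i & Hh & Hi & ->).
      exists (io h), (io i); rewrite io_mem, io_pair; repeat split; auto.
      destruct Hi; subst; auto.
    + intros (h & i & Hh & Hi & ->); apply io_surj in Hh; destruct Hh as (h' & Hh & ->).
      destruct Hi; subst; rewrite <- io_pair; apply io_mem; auto.
  - rewrite <- io_prod; exact (io_func (ss_dist S)).
  - intros y Hy; apply io_surj in Hy; destruct Hy as (x & Hx & ->).
    rewrite io_d, (ss_refl S) by assumption; reflexivity.
  - intros x y Hx Hy; apply io_surj in Hx; destruct Hx as (x' & Hx & ->).
    apply io_surj in Hy; destruct Hy as (y' & Hy & ->).
    rewrite !io_d, (ss_sym S Hx Hy) by assumption; reflexivity.
  - intros x y z e Hx Hy Hz; apply io_surj in Hx; destruct Hx as (x' & Hx & ->).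
    apply io_surj in Hy; destruct Hy as (y' & Hy & ->).
    apply io_surj in Hz; destruct Hz as (z' & Hz & ->).
    rewrite !io_d by assumption; intros L.
    destruct (wle_car HY io_ordered_monoid L) as [_ He]; simpl in He.
    apply io_surj in He; destruct He as (e' & He & ->).
    rewrite !io_wle in *; now apply (ss_ultra S Hx Hy Hz).
  - exact (io_func (ss_func S)).
  - intros h Hh; apply io_surj in Hh; destruct Hh as (h' & Hh & ->).
    rewrite <- !io_pair, io_f, (ss_swap0 S) by auto; reflexivity.
  - intros h Hh; apply io_surj in Hh; destruct Hh as (h' & Hh & ->).
    rewrite <- !io_pair, io_f, (ss_swap1 S) by auto; reflexivity.
  - intros x y Hx Hy; apply io_surj in Hx; destruct Hx as (x' & Hx & ->).
    apply io_surj in Hy; destruct Hy as (y' & Hy & ->).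
    rewrite !io_f, !io_d, (ss_isom S) by
      (assumption || exact (app_in HX (ss_func S) Hx) || exact (app_in HX (ss_func S) Hy)).
    reflexivity.
  - intros h Hh; apply io_surj in Hh; destruct Hh as (h' & Hh & ->).
    rewrite <- io_wpos; exact (io_func (ss_seq S Hh)).
  - intros h h' i i' n Hh Hh' Hx Hy Hn A.
    apply io_surj in Hh; destruct Hh as (g & Hg & ->).
    apply io_surj in Hh'; destruct Hh' as (g' & Hg' & ->).
    apply io_surj in Hn; destruct Hn as (m & Hm & ->).
    destruct (io_surj Hx) as (x & Hx' & E).
    destruct (proj1 (ss_pts S x) Hx') as (h & j & _ & _ & ->).
    rewrite io_pair in E; apply (pair_inj HY) in E; destruct E as [E ->].
    apply io_inj in E; subst h.
    destruct (io_surj Hy) as (y & Hy' & E).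
    destruct (proj1 (ss_pts S y) Hy') as (h & j' & _ & _ & ->).
    rewrite io_pair in E; apply (pair_inj HY) in E; destruct E as [E ->].
    apply io_inj in E; subst h.
    rewrite <- !io_pair, io_d, io_seq_app, io_wle by assumption.
    apply (ss_agree S); try assumption.
    intros k Hk K; apply io_inj; rewrite <- !io_seq_app by assumption.
    apply A; [now apply io_mem|]; unfold upto in *; rewrite io_mem.
    destruct K; subst; auto.
  - intros r Hr; rewrite <- io_wpos in Hr; apply io_surj in Hr; destruct Hr as (r' & Hr & ->).
    destruct (ss_const S Hr) as (h & Hh & C); exists (io h); rewrite io_mem.
    split; [exact Hh|]; intros k Hk; apply io_surj in Hk; destruct Hk as (k' & Hk & ->).
    rewrite io_seq_app, C by assumption; reflexivity.
  - intros h n r Hh Hn Hr; rewrite <- io_wpos in Hr.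
    apply io_surj in Hr; destruct Hr as (r' & Hr & ->).
    apply io_surj in Hh; destruct Hh as (h' & Hh & ->).
    apply io_surj in Hn; destruct Hn as (n' & Hn & ->).
    destruct (ss_update S Hh Hn Hr) as (g & Hg & E & C); exists (io g); rewrite io_mem.
    split; [exact Hg|]; split; [rewrite io_seq_app, E by assumption; reflexivity|].
    intros k Hk Nk; apply io_surj in Hk; destruct Hk as (k' & Hk & ->).
    rewrite !io_seq_app, C by (assumption || congruence); reflexivity.
Qed.

End Transfer.

(** * The Dedekind-MacNeille completion *)

Section Completion.
Context {X : membership} (HX : ZFC X) (W : monoid_data X).
Context (OM : ordered_monoid W).
Implicit Types (a b c f p q s t x y z u v A B Z k m n : X).

Notation C := (completion W).

Lemma in_cuts A : A ∈ cuts W <-> is_cut W A.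
Proof.
  unfold cuts; rewrite in_sep; [|assumption|unfold is_cut, upper_bound; definability].
  split; [tauto|]; intros H; split; [|exact H]; apply in_power; [assumption|].
  apply H.
Qed.

Lemma cut_car A x : A ∈ cuts W -> x ∈ A -> x ∈ car W.
Proof. intros H; apply in_cuts in H; apply H. Qed.

Lemma cut_down A x y : A ∈ cuts W -> wle W x y -> y ∈ A -> x ∈ A.
Proof.
  intros H L Hy; apply in_cuts in H; destruct H as [S H].
  apply H; [now apply (wle_car HX OM) in L|]; intros u [Hu U].
  now apply (wle_trans OM) with y; [|apply U].
Qed.

Lemma cut_zero A : A ∈ cuts W -> zero W ∈ A.
Proof.
  intros H; apply in_cuts in H; destruct H as [S H]; apply H; [now apply zero_car|].
  intros u [Hu _]; now apply zero_wle.
Qed.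

(** Cuts are the sets of lower bounds; all cuts below are produced in this
    way. *)
Lemma lower_cut A (Q : X -> Prop) : (forall u, Q u -> u ∈ car W) ->
  (forall x, x ∈ A <-> x ∈ car W /\ forall u, Q u -> wle W x u) -> A ∈ cuts W.
Proof.
  intros HQ HA; apply in_cuts; split; [intros x Hx; now apply HA in Hx|].
  intros x Hx; split; [intros H u [_ U]; now apply U|].
  intros H; apply HA; split; [exact Hx|]; intros u Hu; apply H; split; [now apply HQ|].
  intros a Ha; apply HA in Ha; now apply Ha.
Qed.

Lemma in_down a x : x ∈ down W a <-> wle W x a.
Proof.
  unfold down; rewrite in_sep; [|assumption|definability].
  split; [tauto|]; intros H; split; [now apply (wle_car HX OM) in H|exact H].
Qed.

Lemma down_cut a : a ∈ car W -> down W a ∈ cuts W.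
Proof.
  intros Ha; apply lower_cut with (fun u => u = a); [congruence|].
  intros x; rewrite in_down; split.
  - intros H; split; [now apply (wle_car HX OM) in H|congruence].
  - intros [_ H]; now apply H.
Qed.

Lemma in_cut_add A B x : x ∈ cut_add W A B <-> x ∈ car W /\
  forall u v, upper_bound W A u -> upper_bound W B v -> wle W x (wadd W u v).
Proof.
  destruct OM as ((F & _) & _).
  pose proof (fun x y y' => func_fun HX (x:=x) (y:=y) (y':=y') F).
  unfold cut_add; rewrite in_sep; [tauto|assumption|unfold upper_bound; definability].
Qed.

Lemma cut_add_cut A B : cut_add W A B ∈ cuts W.
Proof.
  apply lower_cut with (fun s => exists u v, upper_bound W A u /\ upper_bound W B v /\
    s = wadd W u v).
  - intros s (u & v & [Hu _] & [Hv _] & ->); now apply wadd_car.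
  - intros x; rewrite in_cut_add; split; intros [Hx H]; split; auto.
    + intros s (u & v & Hu & Hv & ->); auto.
    + intros u v Hu Hv; apply H; eauto.
Qed.

Lemma completion_wle A B :
  wle C A B <-> A ∈ cuts W /\ B ∈ cuts W /\ subset A B.
Proof.
  unfold wle; simpl; rewrite in_sep; [|assumption|definability].
  rewrite in_prod_pair by assumption; split.
  - intros (_ & A' & B' & HA & HB & E & S); apply (pair_inj HX) in E.
    destruct E; subst; auto.
  - intros (HA & HB & S); eauto 8.
Qed.

Lemma completion_antisym A B : wle C A B -> wle C B A -> A = B.
Proof.
  rewrite !completion_wle; intros (_ & _ & H) (_ & _ & H').
  apply (set_ext HX); split; auto.
Qed.

Lemma completion_add_func : is_func (add C) (prod (car C) (car C)) (car C).
Proof.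
  pose proof OM as ((F & _) & _).
  pose proof (fun x y y' => func_fun HX (x:=x) (y:=y) (y':=y') F).
  assert (H0 : forall t, t ∈ add C <-> exists A B, A ∈ cuts W /\ B ∈ cuts W /\
    t = pair (pair A B) (cut_add W A B)).
  { intros t; simpl; rewrite in_sep; [|assumption|unfold cut_add, upper_bound; definability].
    split; [tauto|]; intros (A & B & HA & HB & ->); split; [|eauto].
    apply in_prod_pair; [assumption|]; split; [now apply in_prod_pair|apply cut_add_cut]. }
  split.
  - intros t Ht; apply H0 in Ht; destruct Ht as (A & B & HA & HB & ->).
    exists (pair A B), (cut_add W A B); split; [now apply in_prod_pair|].
    split; [apply cut_add_cut|reflexivity].
  - intros t Ht; apply in_prod in Ht; [|assumption].
    destruct Ht as (A & B & HA & HB & ->); exists (cut_add W A B); split.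
    + apply H0; eauto.
    + intros Z HZ; apply H0 in HZ; destruct HZ as (A' & B' & _ & _ & E).
      apply (pair_inj HX) in E; destruct E as [E E'].
      apply (pair_inj HX) in E; destruct E; subst; reflexivity.
Qed.

Lemma completion_wadd A B : A ∈ cuts W -> B ∈ cuts W -> wadd C A B = cut_add W A B.
Proof.
  intros HA HB; unfold wadd, app2.
  pose proof OM as ((F & _) & _).
  pose proof (fun x y y' => func_fun HX (x:=x) (y:=y) (y':=y') F).
  apply (app_eq HX completion_add_func); simpl.
  rewrite in_sep; [|assumption|unfold cut_add, upper_bound; definability].
  split; [|eauto].
  apply in_prod_pair; [assumption|]; split; [now apply in_prod_pair|apply cut_add_cut].
Qed.

Lemma completion_wle_addl A B : A ∈ cuts W -> B ∈ cuts W -> wle C A (wadd C A B).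
Proof.
  intros HA HB; rewrite completion_wadd by assumption.
  apply completion_wle; split; [exact HA|]; split; [apply cut_add_cut|].
  intros x Hx; apply in_cut_add; split; [eauto using cut_car|].
  intros u v [Hu U] [Hv V]; apply (wle_trans OM) with u; [auto|].
  now apply wle_addl.
Qed.

Lemma completion_wle_addr A B : A ∈ cuts W -> B ∈ cuts W -> wle C B (wadd C A B).
Proof.
  intros HA HB; rewrite completion_wadd by assumption.
  apply completion_wle; split; [exact HB|]; split; [apply cut_add_cut|].
  intros x Hx; apply in_cut_add; split; [eauto using cut_car|].
  intros u v [Hu U] [Hv V]; apply (wle_trans OM) with v; [auto|].
  now apply wle_addr.
Qed.

Lemma completion_zero_le A : A ∈ cuts W -> wle C (zero C) A.
Proof.
  intros HA; apply completion_wle; split; [apply down_cut; now apply zero_car|].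
  split; [exact HA|]; intros x Hx; apply in_down in Hx.
  apply (cut_down HA Hx); now apply cut_zero.
Qed.

Lemma completion_zero_cut : zero C ∈ cuts W.
Proof. apply down_cut; now apply zero_car. Qed.

(** Infima of cuts are intersections. *)
Lemma completion_inf (P : X -> Prop) : definable (fun e => P (e 0)) ->
  (forall A, P A -> A ∈ cuts W) -> exists Z, is_inf C P Z.
Proof.
  intros D HP; set (Z := sep (car W) (fun x => forall A, P A -> x ∈ A)).
  assert (HZ : forall x, x ∈ Z <-> x ∈ car W /\ forall A, P A -> x ∈ A).
  { apply in_sep; [assumption|]; definability. }
  assert (CZ : Z ∈ cuts W).
  { apply lower_cut with (fun u => exists A, P A /\ upper_bound W A u).
    - intros u (A & _ & Hu & _); exact Hu.
    - intros x; rewrite HZ; split; intros [Hx H]; split; auto.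
      + intros u (A & HA & _ & U); auto.
      + intros A HA; pose proof (HP A HA) as CA; apply in_cuts in CA.
        apply CA; [exact Hx|]; intros u U; apply H; eauto. }
  exists Z; split; [exact CZ|]; split.
  - intros A HA; apply completion_wle; split; [exact CZ|]; split; [auto|].
    intros x Hx; apply HZ in Hx; now apply Hx.
  - intros B HB L; apply completion_wle; split; [exact HB|]; split; [exact CZ|].
    intros x Hx; apply HZ; split; [eauto using cut_car|].
    intros A HA; apply L, completion_wle in HA; now apply HA.
Qed.

(** The supremum consists of the elements below every common upper bound. *)
Lemma completion_sup (P : X -> Prop) : definable (fun e => P (e 0)) ->
  (forall A, P A -> A ∈ cuts W) -> exists Z, is_sup C P Z.
Proof.
  intros D HP.
  (* the common upper bounds of the cuts in [P] *)
  set (U := fun u => u ∈ car W /\ forall A, P A -> forall a, a ∈ A -> wle W a u).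
  set (Z := sep (car W) (fun x => forall u, U u -> wle W x u)).
  assert (HZ : forall x, x ∈ Z <-> x ∈ car W /\ forall u, U u -> wle W x u).
  { apply in_sep; [assumption|]; unfold U; definability. }
  assert (CZ : Z ∈ cuts W) by (apply lower_cut with U; [intros u Hu; apply Hu|exact HZ]).
  exists Z; split; [exact CZ|]; split.
  - intros A HA; apply completion_wle; split; [auto|]; split; [exact CZ|].
    intros x Hx; apply HZ; split; [eauto using cut_car|].
    intros u [_ Hu]; eauto.
  - intros B HB L; apply completion_wle; split; [exact CZ|]; split; [exact HB|].
    intros x Hx; apply HZ in Hx; destruct Hx as [Hx H].
    pose proof HB as CB; apply in_cuts in CB; apply CB; [exact Hx|].
    intros u [Hu UB]; apply H; split; [exact Hu|].
    intros A HA a Ha; apply UB; apply L, completion_wle in HA; now apply HA.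
Qed.

(** A cut is positive when it contains a positive element of [W], so positive
    elements of [W] are coinitial among the positive cuts. *)
Lemma completion_pos A : A ∈ wpos C <-> A ∈ cuts W /\ exists x, x ∈ A /\ x ∈ wpos W.
Proof.
  rewrite in_wpos by assumption; simpl; split.
  - intros [HA N]; split; [exact HA|]; apply NNPP; intros E; apply N.
    apply (set_ext HX); intros x; rewrite in_down; split.
    + intros Hx; replace x with (zero W); [apply wle_refl; auto; now apply zero_car|].
      apply NNPP; intros Nx; apply E; exists x; split; [exact Hx|].
      apply in_wpos; [assumption|]; split; [eauto using cut_car|congruence].
    + intros Hx; apply (wle_zero HX OM) in Hx; subst x; now apply cut_zero.
  - intros (HA & x & Hx & Px); split; [exact HA|]; intros ->.
    apply in_down, (wle_zero HX OM) in Hx; subst x; apply in_wpos in Px; tauto.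
Qed.

Lemma down_pos a : a ∈ wpos W -> down W a ∈ wpos C.
Proof.
  intros Ha; pose proof (wpos_car HX Ha); apply completion_pos.
  split; [now apply down_cut|]; exists a; split; [|exact Ha].
  now apply in_down, wle_refl.
Qed.

Lemma down_le a b : wle W a b -> wle C (down W a) (down W b).
Proof.
  intros H; pose proof (wle_car HX OM H); apply completion_wle.
  split; [now apply down_cut|]; split; [now apply down_cut|].
  intros x; rewrite !in_down; intros Hx; now apply (wle_trans OM) with a.
Qed.

Lemma down_le_cut a A : A ∈ cuts W -> a ∈ A -> wle C (down W a) A.
Proof.
  intros HA Ha; apply completion_wle; split; [apply down_cut; eauto using cut_car|].
  split; [exact HA|]; intros x Hx; apply in_down in Hx; exact (cut_down HA Hx Ha).
Qed.

Lemma completion_wle_trans A B Z : wle C A B -> wle C B Z -> wle C A Z.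
Proof.
  rewrite !completion_wle; intros (HA & _ & H) (_ & HZ & H'); repeat split; auto.
  intros x Hx; auto.
Qed.

Lemma completion_wle_refl A : A ∈ cuts W -> wle C A A.
Proof. intros HA; apply completion_wle; repeat split; auto; now intros x. Qed.

(** Sums of two principal cuts already have infimum 0. *)
Lemma completion_continuous : continuous_at_0 W ->
  is_inf C (fun x => exists a b, a ∈ wpos C /\ b ∈ wpos C /\ x = wadd C a b) (zero C).
Proof.
  intros HC; split; [exact completion_zero_cut|]; split.
  - intros Z (A & B & HA & HB & ->); apply completion_pos in HA; apply completion_pos in HB.
    apply completion_zero_le; rewrite completion_wadd by tauto; apply cut_add_cut.
  - intros Z HZ L; apply completion_wle; split; [exact HZ|].
    split; [exact completion_zero_cut|]; intros x Hx; apply in_down.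
    apply HC; [eauto using cut_car|].
    intros s (a & b & Ha & Hb & ->).
    assert (K : wle C Z (wadd C (down W a) (down W b)))
      by (apply L; exists (down W a), (down W b); auto using down_pos).
    pose proof (wpos_car HX Ha) as Ha'; pose proof (wpos_car HX Hb) as Hb'.
    apply completion_wle in K; destruct K as (_ & _ & K).
    apply K in Hx; rewrite completion_wadd in Hx by (now apply down_cut).
    apply in_cut_add in Hx; destruct Hx as [_ Hx].
    apply Hx; (split; [assumption|]); intros y Hy; now apply in_down in Hy.
Qed.

End Completion.

(** * The Cauchy completion of an isometric involution *)

Section CauchyCompletion.
Context {X : membership} (HX : ZFC X) (W : monoid_data X).
Context (OM : ordered_monoid W) (HC : continuous_at_0 W).
Context (M : space X) (f : X).
Context (FD : is_func (dist M) (prod (pts M) (pts M)) (car W)).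
Context (Drefl : forall x, x ∈ pts M -> d M x x = zero W).
Context (Dsym : forall x y, x ∈ pts M -> y ∈ pts M -> d M x y = d M y x).
Context (Dultra : forall x y z e, x ∈ pts M -> y ∈ pts M -> z ∈ pts M ->
  wle W (d M x y) e -> wle W (d M y z) e -> wle W (d M x z) e).
Context (Ff : is_func f (pts M) (pts M)).
Context (Finv : forall x, x ∈ pts M -> app f (app f x) = x).
Context (Fiso : forall x y, x ∈ pts M -> y ∈ pts M -> d M (app f x) (app f y) = d M x y).
Implicit Types (a b c p q r s t x y z u v A Z k m n : X).

Notation C := (completion W).
Notation B := (base_change W M).
Notation CS := (cauchy_sequences C B).

Let anti := completion_antisym HX (W := W).

Lemma dM_car x y : x ∈ pts M -> y ∈ pts M -> d M x y ∈ car W.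
Proof. intros Hx Hy; apply (app_in HX FD); now apply in_prod_pair. Qed.

Let f_in x : x ∈ pts M -> app f x ∈ pts M.
Proof. exact (app_in HX Ff (x := x)). Qed.

Lemma in_distB t : t ∈ dist B <->
  exists x y, x ∈ pts M /\ y ∈ pts M /\ t = pair (pair x y) (down W (d M x y)).
Proof.
  pose proof (fun x y y' => func_fun HX (x:=x) (y:=y) (y':=y') FD).
  simpl; unfold mkfun; rewrite in_sep; [|assumption|unfold down; definability].
  split.
  - intros (_ & z & Hz & ->); apply in_prod in Hz; [|assumption].
    destruct Hz as (x & y & Hx & Hy & ->); exists x, y; auto.
  - intros (x & y & Hx & Hy & ->); split.
    + apply in_prod_pair; [assumption|]; split; [now apply in_prod_pair|].
      apply down_cut; auto using dM_car.
    + exists (pair x y); split; [now apply in_prod_pair|reflexivity].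
Qed.

Lemma distB_func : is_func (dist B) (prod (pts B) (pts B)) (car C).
Proof.
  split.
  - intros t Ht; apply in_distB in Ht; destruct Ht as (x & y & Hx & Hy & ->).
    exists (pair x y), (down W (d M x y)); split; [now apply in_prod_pair|].
    split; [apply down_cut; auto using dM_car|reflexivity].
  - intros t Ht; apply in_prod in Ht; [|assumption].
    destruct Ht as (x & y & Hx & Hy & ->); exists (down W (d M x y)); split.
    + apply in_distB; eauto.
    + intros z Hz; apply in_distB in Hz; destruct Hz as (x' & y' & _ & _ & E).
      apply (pair_inj HX) in E; destruct E as [E ->].
      apply (pair_inj HX) in E; destruct E; subst; reflexivity.
Qed.

Lemma dB x y : x ∈ pts M -> y ∈ pts M -> d B x y = down W (d M x y).
Proof. intros Hx Hy; apply (app_eq HX distB_func), in_distB; eauto. Qed.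

Let distB_fun x y y' : pair x y ∈ dist B -> pair x y' ∈ dist B -> y = y'.
Proof. exact (func_fun HX distB_func). Qed.

Let addC_fun x y y' : pair x y ∈ add C -> pair x y' ∈ add C -> y = y'.
Proof. exact (func_fun HX (completion_add_func HX OM)). Qed.

Let f_fun x y y' : pair x y ∈ f -> pair x y' ∈ f -> y = y'.
Proof. exact (func_fun HX Ff). Qed.

(** The formula uses [uapp] in place of [app], which is harmless because [p]
    is required to be a function. *)
Lemma in_CS p : p ∈ CS <-> is_cauchy C B p.
Proof.
  unfold cauchy_sequences; rewrite in_sep; [|assumption|].
  - split; [tauto|]; intros H; split; [|exact H].
    destruct H as (A & SA & Fp & _); apply in_power; [assumption|]; intros t Ht.
    destruct (proj1 Fp t Ht) as (x & y & Hx & Hy & ->).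
    apply in_prod_pair; [assumption|]; split; [|exact Hy].
    eapply wpos_car; eauto.
  - apply definable_ext with (fun e => exists A, subset A (wpos C) /\
      is_func (e 0) A (pts B) /\
      is_inf C (fun x => exists a b, a ∈ A /\ b ∈ A /\ x = wadd C a b) (zero C) /\
      (forall a b, a ∈ A -> b ∈ A ->
        wle C (d B (uapp (e 0) a) (uapp (e 0) b)) (wadd C a b))).
    + intros e; split; intros (A & SA & Fp & IA & H); exists A; do 3 (split; [assumption|]);
        intros a b Ha Hb; pose proof (H a b Ha Hb) as H';
        rewrite !(app_uapp HX Fp) in * by assumption; exact H'.
    + pose proof distB_fun; pose proof addC_fun.
      definability.
Qed.

Lemma cauchy_func p : p ∈ CS -> exists A, is_func p A (pts M) /\ subset A (wpos C).
Proof. intros H; apply in_CS in H; destruct H as (A & SA & Fp & _); eauto. Qed.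

Lemma cauchy_app p a : p ∈ CS -> in_dom p a ->
  app p a ∈ pts M /\ a ∈ wpos C /\ app p a = uapp p a.
Proof.
  intros H [y Hy]; destruct (cauchy_func H) as (A & Fp & SA).
  destruct (func_dom HX Fp Hy) as [Ha Hy'].
  split; [exact (app_in HX Fp Ha)|]; split; [auto|exact (app_uapp HX Fp Ha)].
Qed.

Definition near p q c z : Prop := exists a b, in_dom p a /\ in_dom q b /\
  wle C a c /\ wle C b c /\ z = d B (app p a) (app q b).

Definition unear p q c z : Prop := exists a b, in_dom p a /\ in_dom q b /\
  wle C a c /\ wle C b c /\ z = d B (uapp p a) (uapp q b).

Lemma near_unear p q : p ∈ CS -> q ∈ CS -> near p q = unear p q.
Proof.
  intros Hp Hq; apply functional_extensionality; intros c.
  apply functional_extensionality; intros z; apply propositional_extensionality.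
  split; intros (a & b & Ha & Hb & La & Lb & ->); exists a, b;
    do 4 (split; [assumption|]);
    destruct (cauchy_app Hp Ha) as (_ & _ & E); destruct (cauchy_app Hq Hb) as (_ & _ & E');
    congruence.
Qed.

(** A form of the distance that is definable in both arguments. *)
Definition ucauchy_dist p q : X :=
  wsup C (fun y => exists c, c ∈ wpos C /\ y = winf C (unear p q c)).

Lemma cauchy_dist_near p q : cauchy_dist C B p q =
  wsup C (fun y => exists c, c ∈ wpos C /\ y = winf C (near p q c)).
Proof. reflexivity. Qed.

Lemma cauchy_dist_u p q : p ∈ CS -> q ∈ CS -> cauchy_dist C B p q = ucauchy_dist p q.
Proof. intros Hp Hq; now rewrite cauchy_dist_near, near_unear. Qed.

Lemma dterm_ucauchy_dist (s t : (nat -> X) -> X) :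
  dterm s -> dterm t -> dterm (fun e => ucauchy_dist (s e) (t e)).
Proof.
  intros Hs Ht; unfold ucauchy_dist, unear.
  apply (dterm_wsup anti HX); cbv beta.
  apply definable_ex, definable_and; [definability|].
  apply definable_eq; [definability|].
  apply (dterm_winf anti HX).
  pose proof distB_fun; definability.
Qed.

Lemma near_cut p q c z : p ∈ CS -> q ∈ CS -> near p q c z -> z ∈ cuts W.
Proof.
  intros Hp Hq (a & b & Ha & Hb & _ & _ & ->).
  destruct (cauchy_app Hp Ha) as (Pa & _); destruct (cauchy_app Hq Hb) as (Qb & _).
  rewrite dB by assumption; apply down_cut; auto using dM_car.
Qed.

Lemma winf_near p q c : p ∈ CS -> q ∈ CS -> is_inf C (near p q c) (winf C (near p q c)).
Proof.
  intros Hp Hq; apply (the_spec (zero C) (P := is_inf C (near p q c))).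
  apply completion_inf; [assumption|..].
  - rewrite near_unear by assumption; unfold unear.
    pose proof distB_fun; definability.
  - intros z; now apply near_cut.
Qed.

Lemma cauchy_dist_sup p q : p ∈ CS -> q ∈ CS ->
  is_sup C (fun y => exists c, c ∈ wpos C /\ y = winf C (near p q c))
    (cauchy_dist C B p q).
Proof.
  intros Hp Hq; apply (the_spec (zero C) (P := is_sup C (fun y => exists c, c ∈ wpos C /\
    y = winf C (near p q c)))).
  apply completion_sup; [assumption|..].
  - rewrite near_unear by assumption; unfold unear.
    apply definable_ex, definable_and; [definability|].
    apply definable_eq; [definability|]; apply (dterm_winf anti HX).
    pose proof distB_fun; definability.
  - intros z (c & Hc & ->); now apply winf_near.
Qed.

Lemma cauchy_dist_cut p q : p ∈ CS -> q ∈ CS -> cauchy_dist C B p q ∈ cuts W.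
Proof. intros Hp Hq; now apply cauchy_dist_sup. Qed.

(** Being 0 means that every infimum near 0 is 0.  The distances in question
    are principal cuts, so an infimum vanishes when they become arbitrarily
    small in [W], which has no least positive element. *)
Lemma cauchy_dist_zero p q : p ∈ CS -> q ∈ CS ->
  cauchy_dist C B p q = zero C <->
  forall c e, c ∈ wpos C -> e ∈ wpos W -> exists a b, in_dom p a /\ in_dom q b /\
    wle C a c /\ wle C b c /\ wle W (d M (app p a) (app q b)) e.
Proof.
  intros Hp Hq; split.
  (* otherwise the principal cut of [e] is a lower bound *)
  - intros E c e Hc He; apply NNPP; intros N.
    destruct (cauchy_dist_sup Hp Hq) as (_ & L & _).
    assert (Lc : wle C (winf C (near p q c)) (zero C)) by (rewrite <- E; apply L; eauto).
    destruct (winf_near c Hp Hq) as (_ & _ & G).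
    pose proof (wpos_car HX He) as He'.
    assert (K : wle C (down W e) (zero C)).
    { refine (completion_wle_trans HX (B := winf C (near p q c)) _ Lc).
      apply G; [now apply down_cut|]; intros z (a & b & Ha & Hb & La & Lb & ->).
      destruct (cauchy_app Hp Ha) as (Pa & _); destruct (cauchy_app Hq Hb) as (Qb & _).
      rewrite dB by assumption; apply down_le; [assumption|assumption|].
      apply (not_wle OM); auto using dM_car; intros Le; apply N; exists a, b; auto. }
    apply completion_wle in K; [|assumption]; destruct K as (_ & _ & K).
    assert (Ke : e ∈ down W (zero W))
      by (apply K, in_down; try assumption; now apply wle_refl).
    apply (in_down HX OM), (wle_zero HX OM) in Ke; subst e.
    apply in_wpos in He; tauto.
  - intros H; apply anti; [|apply completion_zero_le; auto using cauchy_dist_cut].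
    apply (cauchy_dist_sup Hp Hq); [now apply completion_zero_cut|].
    intros z (c & Hc & ->).
    destruct (winf_near c Hp Hq) as (I & L & _).
    apply completion_wle; [assumption|]; split; [exact I|].
    split; [now apply completion_zero_cut|]; intros x Hx; apply in_down; [assumption|assumption|].
    rewrite (wle_all_pos HX OM HC (x := x)).
    + apply wle_refl; [assumption|now apply zero_car].
    + exact (cut_car HX I Hx).
    + intros e He; destruct (H c e Hc He) as (a & b & Ha & Hb & La & Lb & Le).
      assert (K : wle C (winf C (near p q c)) (d B (app p a) (app q b)))
        by (apply L; exists a, b; auto).
      destruct (cauchy_app Hp Ha) as (Pa & _); destruct (cauchy_app Hq Hb) as (Qb & _).
      apply completion_wle in K; [|assumption]; destruct K as (_ & _ & K).
      apply K in Hx; rewrite dB, in_down in Hx by assumption.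
      exact (wle_trans OM Hx Le).
Qed.

Lemma in_class p q : p ∈ CS -> q ∈ cauchy_class C B p <-> q ∈ CS /\ cauchy_equiv C B p q.
Proof.
  intros Hp; unfold cauchy_class.
  rewrite (sep_ext (Q := fun x => ucauchy_dist p x = zero C /\ ucauchy_dist x p = zero C)).
  - rewrite in_sep; [|assumption|].
    + unfold cauchy_equiv; split; intros [Hq H]; split; auto;
        rewrite !cauchy_dist_u in * by assumption; exact H.
    + apply definable_and; (apply definable_eq; [apply dterm_ucauchy_dist|]); definability.
  - intros x Hx; unfold cauchy_equiv; rewrite !cauchy_dist_u by assumption; tauto.
Qed.

(** Describes the class by its elements, in definable terms; equality with
    [cauchy_class] itself is not visibly first-order. *)
Lemma class_eq p c : p ∈ CS ->
  c = cauchy_class C B p <-> forall q, q ∈ c <-> q ∈ CS /\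
    ucauchy_dist p q = zero C /\ ucauchy_dist q p = zero C.
Proof.
  intros Hp; split.
  - intros -> q; rewrite in_class by assumption; unfold cauchy_equiv.
    split; intros [Hq H]; split; auto; rewrite !cauchy_dist_u in * by assumption; exact H.
  - intros H; apply (set_ext HX); intros q; rewrite H, in_class by assumption.
    unfold cauchy_equiv.
    split; intros [Hq K]; split; auto; rewrite !cauchy_dist_u in * by assumption; exact K.
Qed.

Lemma definable_class (s t : (nat -> X) -> X) : dterm s -> dterm t ->
  definable (fun e => forall q, q ∈ s e <-> q ∈ CS /\
    ucauchy_dist (t e) q = zero C /\ ucauchy_dist q (t e) = zero C).
Proof.
  intros Hs Ht; apply definable_all, definable_iff; [definability|].
  apply definable_and; [definability|].
  apply definable_and; (apply definable_eq; [apply dterm_ucauchy_dist|]); definability.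
Qed.

Notation Cl := (cauchy_classes C B).

Lemma in_classes c : c ∈ Cl <-> exists p, p ∈ CS /\ c = cauchy_class C B p.
Proof.
  unfold cauchy_classes; rewrite in_sep; [|assumption|].
  - split; [tauto|]; intros (p & Hp & ->); split; [|eauto].
    apply in_power; [assumption|]; intros q Hq; now apply in_class in Hq.
  - apply definable_ext with (fun e => exists p, p ∈ CS /\ forall q, q ∈ e 0 <-> q ∈ CS /\
      ucauchy_dist p q = zero C /\ ucauchy_dist q p = zero C).
    + intros e; split; intros (p & Hp & H); exists p; (split; [exact Hp|]); 
        now apply class_eq.
    + apply definable_ex, definable_and; [definability|]; apply definable_class; definability.
Qed.

Lemma in_cc_dist x y z : pair (pair x y) z ∈ dist (cc_continuous C B) <->
  exists p q, p ∈ CS /\ q ∈ CS /\ x = cauchy_class C B p /\ y = cauchy_class C B q /\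
    z = cauchy_dist C B p q.
Proof.
  simpl; rewrite in_sep; [|assumption|].
  - split.
    + intros (_ & p & q & Hp & Hq & E); apply (pair_inj HX) in E; destruct E as [E ->].
      apply (pair_inj HX) in E; destruct E; exists p, q; auto.
    + intros (p & q & Hp & Hq & -> & -> & ->); split; [|eauto].
      apply in_prod_pair; [assumption|]; split; [|now apply cauchy_dist_cut].
      apply in_prod_pair; [assumption|]; split; apply in_classes; eauto.
  - apply definable_ext with (fun e => exists p q, p ∈ CS /\ q ∈ CS /\ exists c c',
      e 0 = pair (pair c c') (ucauchy_dist p q) /\
      (forall r, r ∈ c <-> r ∈ CS /\
        ucauchy_dist p r = zero C /\ ucauchy_dist r p = zero C) /\
      (forall r, r ∈ c' <-> r ∈ CS /\
        ucauchy_dist q r = zero C /\ ucauchy_dist r q = zero C)).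
    + intros e; split.
      * intros (p & q & Hp & Hq & E); exists p, q; do 2 (split; [assumption|]).
        exists (cauchy_class C B p), (cauchy_class C B q).
        rewrite <- cauchy_dist_u by assumption; split; [exact E|].
        split; now apply class_eq.
      * intros (p & q & Hp & Hq & c & c' & E & Ec & Ec'); exists p, q.
        do 2 (split; [assumption|]); apply class_eq in Ec; [|assumption].
        apply class_eq in Ec'; [|assumption].
        rewrite cauchy_dist_u by assumption; subst; exact E.
    + do 2 apply definable_ex; apply definable_and; [definability|]; apply definable_and; [definability|].
      do 2 apply definable_ex; apply definable_and.
      * apply definable_eq; [definability|]; apply (dterm_pair HX); [definability|].
        apply dterm_ucauchy_dist; definability.
      * apply definable_and; apply definable_class; definability.
Qed.

(** Induces the extension of [f] on classes of Cauchy sequences. *)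
Definition push p : X :=
  sep (prod (car C) (pts M)) (fun t => exists a x, pair a x ∈ p /\ t = pair a (app f x)).

Lemma in_push p a y : p ∈ CS ->
  pair a y ∈ push p <-> exists x, pair a x ∈ p /\ y = app f x.
Proof.
  intros Hp; unfold push; pose proof f_fun; rewrite in_sep; [|assumption|definability].
  split.
  - intros (_ & a' & x & Hx & E); apply (pair_inj HX) in E; destruct E; subst; eauto.
  - intros (x & Hx & ->); destruct (cauchy_func Hp) as (A & Fp & SA).
    destruct (func_dom HX Fp Hx) as [Ha Px]; split; [|eauto].
    apply in_prod_pair; [assumption|]; split; [|now apply f_in].
    eapply wpos_car; eauto.
Qed.

Lemma push_func p A : p ∈ CS -> is_func p A (pts M) ->
  is_func (push p) A (pts M) /\ forall a, a ∈ A -> app (push p) a = app f (app p a).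
Proof.
  intros Hp Fp; assert (F : is_func (push p) A (pts M)).
  { split.
    - intros t Ht; pose proof Ht as Ht'; unfold push in Ht'; pose proof f_fun.
      apply in_sep in Ht'; [|assumption|definability].
      destruct Ht' as (_ & a & x & Hx & ->); destruct (func_dom HX Fp Hx) as [Ha Px].
      exists a, (app f x); auto.
    - intros a Ha; exists (app f (app p a)); split.
      + apply in_push; [assumption|]; exists (app p a); split; [exact (app_pair Fp Ha)|auto].
      + intros y Hy; apply in_push in Hy; [|assumption]; destruct Hy as (x & Hx & ->).
        now rewrite (app_eq HX Fp Hx). }
  split; [exact F|]; intros a Ha; apply (app_eq HX F), in_push; [assumption|].
  exists (app p a); split; [exact (app_pair Fp Ha)|auto].
Qed.

Lemma push_dom p a : p ∈ CS -> in_dom (push p) a <-> in_dom p a.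
Proof.
  intros Hp; split.
  - intros [y Hy]; apply in_push in Hy; [|assumption]; destruct Hy as (x & Hx & _).
    now exists x.
  - intros [x Hx]; exists (app f x); apply in_push; eauto.
Qed.

Lemma push_app p a : p ∈ CS -> in_dom p a -> app (push p) a = app f (app p a).
Proof.
  intros Hp [y Hy]; destruct (cauchy_func Hp) as (A & Fp & SA).
  apply (push_func Hp Fp); now apply (func_dom HX Fp) in Hy.
Qed.

Lemma push_cauchy p : p ∈ CS -> push p ∈ CS.
Proof.
  intros Hp; pose proof Hp as Hp'; apply in_CS in Hp'.
  destruct Hp' as (A & SA & Fp & IA & H); destruct (push_func Hp Fp) as [F E].
  apply in_CS; exists A; do 3 (split; [assumption|]); intros a b Ha Hb.
  pose proof (app_in HX Fp Ha) as Pa; pose proof (app_in HX Fp Hb) as Pb; simpl in Pa, Pb.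
  rewrite !E, dB, Fiso, <- dB by auto; auto.
Qed.

Lemma push_push p : p ∈ CS -> push (push p) = p.
Proof.
  intros Hp; destruct (cauchy_func Hp) as (A & Fp & SA).
  destruct (push_func Hp Fp) as [F E].
  destruct (push_func (push_cauchy Hp) F) as [F' E'].
  apply (func_ext HX F' Fp); intros a Ha.
  rewrite E', E, Finv; auto; exact (app_in HX Fp Ha).
Qed.

(** As [f] is an isometry, both sides are built from the same set of
    distances. *)
Lemma push_dist p q : p ∈ CS -> q ∈ CS ->
  cauchy_dist C B (push p) (push q) = cauchy_dist C B p q.
Proof.
  intros Hp Hq; rewrite !cauchy_dist_near.
  replace (near (push p) (push q)) with (near p q); [reflexivity|].
  apply functional_extensionality; intros c.
  apply functional_extensionality; intros z; apply propositional_extensionality.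
  split; intros (a & b & Ha & Hb & La & Lb & ->); rewrite ?push_dom in * by assumption;
    exists a, b; rewrite ?push_dom by assumption; do 4 (split; [assumption|]);
    destruct (cauchy_app Hp Ha) as (Pa & _); destruct (cauchy_app Hq Hb) as (Qb & _);
    rewrite !push_app, !dB, Fiso by auto; reflexivity.
Qed.

Lemma push_class p q : p ∈ CS -> q ∈ CS ->
  q ∈ cauchy_class C B (push p) <-> push q ∈ cauchy_class C B p.
Proof.
  intros Hp Hq; pose proof (push_cauchy Hp) as Hp'; pose proof (push_cauchy Hq) as Hq'.
  rewrite !in_class by assumption; unfold cauchy_equiv.
  rewrite <- (push_dist Hp Hq'), <- (push_dist Hq' Hp), (push_push Hq); tauto.
Qed.

(** Since [push] is an involution, the image of a class is the set of
    sequences whose push lies in it. *)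
Lemma cc_map_exists : exists g, is_func g Cl Cl /\
  forall p, p ∈ CS -> app g (cauchy_class C B p) = cauchy_class C B (push p).
Proof.
  set (R := fun c c' => forall q, q ∈ c' <-> q ∈ CS /\ push q ∈ c).
  assert (RP : forall p, p ∈ CS -> R (cauchy_class C B p) (cauchy_class C B (push p))).
  { intros p Hp q; pose proof (push_cauchy Hp); split.
    - intros Hq; assert (q ∈ CS) by (now apply in_class in Hq).
      split; [assumption|]; now apply push_class.
    - intros [Hq H']; now apply push_class. }
  assert (U : forall c c' c'', R c c' -> R c c'' -> c' = c'').
  { intros c c' c'' H H'; apply (set_ext HX); intros q; rewrite (H q), (H' q); tauto. }
  destruct (@func_exists X HX Cl Cl R) as (g & Fg & Rg).
  - unfold R, push; pose proof f_fun; definability.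
  - intros c Hc; apply in_classes in Hc; destruct Hc as (p & Hp & ->).
    exists (cauchy_class C B (push p)); split; [|auto].
    apply in_classes; exists (push p); auto using push_cauchy.
  - intros c c' c'' _; apply U.
  - exists g; split; [exact Fg|]; intros p Hp; eapply U; [apply Rg, in_classes; eauto|auto].
Qed.

Lemma const_cauchy x : x ∈ pts M -> constant_sequence C B x ∈ CS /\
  push (constant_sequence C B x) = constant_sequence C B (app f x).
Proof.
  assert (I : forall x t, x ∈ pts M -> t ∈ constant_sequence C B x <->
    exists a, a ∈ wpos C /\ t = pair a x).
  { intros y t Hy; unfold constant_sequence, mkfun; rewrite in_sep; [|assumption|definability].
    split; [tauto|]; intros (a & Ha & ->); split; [|eauto].
    now apply in_prod_pair. }
  assert (F : forall x, x ∈ pts M -> is_func (constant_sequence C B x) (wpos C) (pts M)).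
  { intros y Hy; split.
    - intros t Ht; apply I in Ht; [|assumption]; destruct Ht as (a & Ha & ->); eauto.
    - intros a Ha; exists y; split; [apply I; eauto|].
      intros z Hz; apply I in Hz; [|assumption]; destruct Hz as (a' & _ & E).
      apply (pair_inj HX) in E; destruct E; congruence. }
  assert (V : forall x a, x ∈ pts M -> a ∈ wpos C -> app (constant_sequence C B x) a = x).
  { intros y a Hy Ha; apply (app_eq HX (F y Hy)), I; eauto. }
  intros Hx; assert (Hc : constant_sequence C B x ∈ CS).
  { apply in_CS; exists (wpos C); split; [intros a; auto|]; split; [auto|].
    split; [now apply completion_continuous|]; intros a b Ha Hb.
    rewrite !V, dB, Drefl by assumption; apply completion_zero_le; [assumption|assumption|].
    apply (app_in HX (completion_add_func HX OM)), in_prod_pair; [assumption|].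
    split; eapply wpos_car; eauto. }
  split; [exact Hc|]; destruct (push_func Hc (F x Hx)) as [F' E].
  apply (func_ext HX F' (F _ (f_in Hx))); intros a Ha; rewrite E, !V; auto.
Qed.

(** The distance of two classes is a description over all representatives; any
    solution comes from some pair of Cauchy sequences. *)
Lemma cc_dist_cut x y : x ∈ Cl -> y ∈ Cl -> d (cc_continuous C B) x y ∈ cuts W.
Proof.
  intros Hx Hy; apply in_classes in Hx; apply in_classes in Hy.
  destruct Hx as (p & Hp & ->); destruct Hy as (q & Hq & ->).
  unfold d, app2, app.
  set (P := fun z => pair (pair _ _) z ∈ _).
  assert (H : P (the (pair (cauchy_class C B p) (cauchy_class C B q)) P)).
  { apply the_spec; exists (cauchy_dist C B p q); apply in_cc_dist; exists p, q; auto. }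
  apply in_cc_dist in H; destruct H as (p' & q' & Hp' & Hq' & _ & _ & ->).
  now apply cauchy_dist_cut.
Qed.

(** Pushing representatives is a bijection that preserves distances, so the
    two descriptions have the same solutions. *)
Lemma cc_map_isom g x y : is_func g Cl Cl ->
  (forall p, p ∈ CS -> app g (cauchy_class C B p) = cauchy_class C B (push p)) ->
  x ∈ Cl -> y ∈ Cl ->
  d (cc_continuous C B) (app g x) (app g y) = d (cc_continuous C B) x y.
Proof.
  intros Fg Eg Hx Hy; apply in_classes in Hx; apply in_classes in Hy.
  destruct Hx as (p & Hp & ->); destruct Hy as (q & Hq & ->).
  rewrite !Eg by assumption; apply the_ext; intros z; rewrite !in_cc_dist.
  split; intros (p' & q' & Hp' & Hq' & E & E' & ->); exists (push p'), (push q');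
    rewrite push_dist by assumption; do 2 (split; [now apply push_cauchy|]).
  - rewrite <- !Eg, <- E, <- E', !Eg, !push_push by auto using push_cauchy; auto.
  - rewrite <- !Eg, E, E' by assumption; auto.
Qed.

(** Being at distance 0 from [q] means coming arbitrarily close to [q] along
    small radii.  There [f] moves the terms of [p] by at most [e], and the
    ultrametric inequality exchanges [app p a] with its image. *)
Lemma asymptotically_fixed p : p ∈ CS ->
  (forall e, e ∈ wpos W -> exists c, c ∈ wpos C /\
    forall a, in_dom p a -> wle C a c -> wle W (d M (app p a) (app f (app p a))) e) ->
  cauchy_class C B (push p) = cauchy_class C B p.
Proof.
  intros Hp H; pose proof (push_cauchy Hp) as Hp'.
  (* the bound on the displacement persists below any given radius *)
  assert (S : forall c e, c ∈ wpos C -> e ∈ wpos W -> exists c', c' ∈ wpos C /\ wle C c' c /\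
    forall a, in_dom p a -> wle C a c' -> wle W (d M (app p a) (app f (app p a))) e).
  { intros c e Hc He; destruct (H e He) as (c1 & Hc1 & L).
    apply completion_pos in Hc; [|assumption|assumption].
    apply completion_pos in Hc1; [|assumption|assumption].
    destruct Hc as (Cc & x & Hx & Px); destruct Hc1 as (Cc1 & x1 & Hx1 & Px1).
    destruct (wpos_min HX OM Px Px1) as (y & Hy & Lx & Lx1).
    pose proof (wpos_car HX Hy) as Hy'.
    exists (down W y); split; [now apply down_pos|]; split.
    - apply down_le_cut; auto; exact (cut_down HX OM Cc Lx Hx).
    - intros a Ha La; apply L; [exact Ha|]; apply (completion_wle_trans HX La).
      apply down_le_cut; auto; exact (cut_down HX OM Cc1 Lx1 Hx1). }
  apply (set_ext HX); intros q; rewrite !in_class by assumption; unfold cauchy_equiv.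
  cut (q ∈ CS -> (cauchy_dist C B (push p) q = zero C <-> cauchy_dist C B p q = zero C) /\
         (cauchy_dist C B q (push p) = zero C <-> cauchy_dist C B q p = zero C)).
  { intros K; split; intros [Hq E]; specialize (K Hq); tauto. }
  intros Hq; rewrite !cauchy_dist_zero by assumption; split; split; intros Z c e Hc He;
    destruct (S c e Hc He) as (c' & Hc' & Lc & L);
    destruct (Z c' e Hc' He) as (a & b & Ha & Hb & La & Lb & K);
    rewrite ?push_dom in * by assumption; exists a, b; rewrite ?push_dom by assumption;
    rewrite ?push_app in * by assumption;
    (do 2 (split; [assumption|])); 
    (do 2 (split; [eapply (completion_wle_trans HX); eassumption|])).
  - destruct (cauchy_app Hp Ha) as (Pa & _); destruct (cauchy_app Hq Hb) as (Qb & _).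
    apply (Dultra (y := app f (app p a))); auto.
  - destruct (cauchy_app Hp Ha) as (Pa & _); destruct (cauchy_app Hq Hb) as (Qb & _).
    apply (Dultra (y := app p a)); auto; rewrite Dsym; auto.
  - destruct (cauchy_app Hq Ha) as (Pa & _); destruct (cauchy_app Hp Hb) as (Qb & _).
    apply (Dultra (y := app f (app p b))); auto; rewrite Dsym; auto.
  - destruct (cauchy_app Hq Ha) as (Pa & _); destruct (cauchy_app Hp Hb) as (Qb & _).
    apply (Dultra (y := app p b)); auto.
Qed.

Lemma cc_map_fixed_point p : is_cauchy C B p ->
  (forall e, e ∈ wpos W -> exists c, c ∈ wpos C /\
    forall a, in_dom p a -> wle C a c -> wle W (d M (app p a) (app f (app p a))) e) ->
  exists g, is_cc_map W M f g /\ has_fixed_point (cc W M) g.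
Proof.
  intros Hp H; apply in_CS in Hp; destruct cc_map_exists as (g & Fg & Eg).
  exists g; unfold is_cc_map, cc, cc_embed.
  destruct (excluded_middle_informative (continuous_at_0 W)) as [_|N]; [|tauto].
  split; [split; [split|]|].
  - exact Fg.
  - intros x y Hx Hy; rewrite cc_map_isom by assumption.
    apply completion_wle_refl; [assumption|]; now apply cc_dist_cut.
  - intros x Hx; destruct (const_cauchy Hx) as [Hc <-]; now apply Eg.
  - exists (cauchy_class C B p); split; [apply in_classes; eauto|].
    rewrite Eg by assumption; now apply asymptotically_fixed.
Qed.

End CauchyCompletion.

(** * The new point *)

Section NewPoint.
Context {X : membership} (HX : ZFC X) (W : monoid_data X).
Context (OM : ordered_monoid W) (HC : continuous_at_0 W).
Context (M : space X) (f N w t0 t1 : X) (S : shift_system W M f N w t0 t1).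
Context (Hw : is_omega w) (r : X) (Fr : is_func r w (wpos W)).
Context (Cr : forall x : X, x ∈ wpos W -> exists n, n ∈ w /\ wle W (app r n) x).
Implicit Types (a b c h p q s t x y z u v A Z k m n : X).

Notation C := (completion W).
Notation B := (base_change W M).

Let r_fun x y y' : pair x y ∈ r -> pair x y' ∈ r -> y = y'.
Proof. exact (func_fun HX Fr). Qed.

Let r_pos n : n ∈ w -> app r n ∈ wpos W.
Proof. exact (app_in HX Fr (x := n)). Qed.

(** An induction inside the larger model, with [N] as a parameter: an
    approximation of [r] up to [n] arises by changing one value of the
    previous one. *)
Lemma truncation x n : x ∈ wpos W -> n ∈ w -> exists h, h ∈ N /\ forall k, k ∈ w ->
  (upto k n -> pair k (app r k) ∈ h) /\ (~ upto k n -> pair k x ∈ h).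
Proof.
  intros Hx; revert n.
  assert (V : forall h k y, h ∈ N -> k ∈ w -> app h k = y -> pair k y ∈ h)
    by (intros h k y Hh Hk <-; exact (app_pair (ss_seq S Hh) Hk)).
  refine (omega_ind HX Hw (P := fun n => exists h, h ∈ N /\ forall k, k ∈ w ->
    (upto k n -> pair k (app r k) ∈ h) /\ (~ upto k n -> pair k x ∈ h)) _ _ _).
  - unfold upto; pose proof r_fun; definability.
  - intros n Hn Zn; destruct (ss_const S Hx) as (h & Hh & E).
    destruct (ss_update S Hh Hn (r_pos Hn)) as (h' & Hh' & En & E').
    exists h'; split; [exact Hh'|]; intros k Hk; split.
    + intros [K| ->]; [destruct (Zn _ K)|auto].
    + intros K; apply V; auto; rewrite E', E; auto; intros ->; apply K; now right.
  - intros m n Hm Hn Sn (h & Hh & E).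
    destruct (ss_update S Hh Hn (r_pos Hn)) as (h' & Hh' & En & E').
    exists h'; split; [exact Hh'|]; intros k Hk; destruct (E k Hk) as [E1 E2]; split.
    + intros [K| ->]; [|auto]; apply V; auto; rewrite E'; auto.
      * apply (app_eq HX (ss_seq S Hh)), E1, Sn, K.
      * intros ->; exact (mem_irrefl HX K).
    + intros K; apply V; auto; rewrite E'; auto.
      * apply (app_eq HX (ss_seq S Hh)), E2; intros K'; apply K; left; now apply Sn.
      * intros ->; apply K; now right.
Qed.

(** The first index at which [r] enters the cut [A] governs the term with
    radius [A]: up to this index the term follows [r]. *)
Definition stopped A k : Prop := exists j, j ∈ k /\ app r j ∈ A.

Lemma stopping_time A : A ∈ wpos C -> exists n, n ∈ w /\ app r n ∈ A /\
  forall k, k ∈ w -> stopped A k <-> ~ upto k n.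
Proof.
  intros HA; apply completion_pos in HA; [|assumption|assumption].
  destruct HA as (CA & x & Hx & Px); destruct (Cr Px) as (m & Hm & L).
  destruct (omega_least HX Hw (P := fun n => app r n ∈ A) (n := m)) as (n & Hn & An & Mn).
  - pose proof r_fun; definability.
  - exact Hm.
  - exact (cut_down HX OM CA L Hx).
  - exists n; split; [exact Hn|]; split; [exact An|]; intros k Hk; split.
    + intros (j & Hj & Aj) K.
      assert (Hjn : j ∈ n).
      { destruct K as [K| ->]; [|exact Hj]; exact (omega_mem_trans Hw Hn Hj K). }
      exact (Mn j Hjn Aj).
    + intros K; exists n; split; [|exact An].
      destruct (omega_tri Hw Hk Hn) as [H|[H|H]]; [| |exact H];
        exfalso; apply K; [now left|now right].
Qed.

(** Beyond the stopping time the value is fixed to [x], so that the term is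
    determined by [A] and no choice is involved. *)
Lemma new_sequence : exists p, is_func p (wpos C) (pts M) /\
  forall A, A ∈ wpos C -> exists h, h ∈ N /\ pair h t0 ∈ pts M /\ app p A = pair h t0 /\
    forall k, k ∈ w -> ~ stopped A k -> app h k = app r k.
Proof.
  destruct (omega_zero HX Hw) as (z & Hz & _).
  set (x := app r z); assert (Hx : x ∈ wpos W) by (now apply r_pos).
  set (R := fun A y => exists h, h ∈ N /\ y = pair h t0 /\ forall k, k ∈ w ->
    (~ stopped A k -> pair k (app r k) ∈ h) /\ (stopped A k -> pair k x ∈ h)).
  assert (P : forall h, h ∈ N -> pair h t0 ∈ pts M)
    by (intros h Hh; apply (ss_pts S); eauto 8).
  destruct (@func_exists X HX (wpos C) (pts M) R) as (p & Fp & Rp).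
  - unfold R, stopped; pose proof r_fun; definability.
  - intros A HA; destruct (stopping_time HA) as (n & Hn & _ & K).
    destruct (truncation Hx Hn) as (h & Hh & E).
    exists (pair h t0); split; [auto|]; exists h; split; [exact Hh|]; split; [reflexivity|].
    intros k Hk; destruct (E k Hk) as [E1 E2]; rewrite (K k Hk); split; auto.
    intros K'; apply E1; tauto.
  - intros A y y' HA (h & Hh & -> & E) (h' & Hh' & -> & E').
    replace h' with h; [reflexivity|].
    apply (func_ext HX (ss_seq S Hh) (ss_seq S Hh')); intros k Hk.
    destruct (E k Hk) as [E1 E2]; destruct (E' k Hk) as [E1' E2'].
    destruct (classic (stopped A k)) as [K|K].
    + rewrite (app_eq HX (ss_seq S Hh) (E2 K)); symmetry.
      exact (app_eq HX (ss_seq S Hh') (E2' K)).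
    + rewrite (app_eq HX (ss_seq S Hh) (E1 K)); symmetry.
      exact (app_eq HX (ss_seq S Hh') (E1' K)).
  - exists p; split; [exact Fp|]; intros A HA.
    destruct (Rp A HA) as (h & Hh & E & K); exists h; repeat split; auto.
    intros k Hk Nk; apply (app_eq HX (ss_seq S Hh)); now apply K.
Qed.

(** Two terms with radii [a] and [b] agree up to the first index [n] at which
    [r] enters one of the two cuts, so their distance is at most [app r n],
    hence at most [a] or [b].  With [b = a] the same estimate bounds the
    displacement of a term by its radius. *)
Lemma new_fixed_point :
  exists g, is_cc_map W M f g /\ has_fixed_point (cc W M) g.
Proof.
  destruct new_sequence as (p & Fp & Vp).
  assert (Inv : forall x, x ∈ pts M -> app f (app f x) = x).
  { intros x Hx; apply (ss_pts S) in Hx; destruct Hx as (h & i & Hh & [-> | ->] & ->).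
    - now rewrite (ss_swap0 S Hh), (ss_swap1 S Hh).
    - now rewrite (ss_swap1 S Hh), (ss_swap0 S Hh). }
  apply (cc_map_fixed_point HX OM HC (ss_dist S) (ss_refl S) (ss_sym S) (ss_ultra S)
    (ss_func S) Inv (ss_isom S) (p := p)).
  - exists (wpos C); split; [intros a; auto|]; split; [exact Fp|].
    split; [now apply completion_continuous|]; intros a b Ha Hb.
    destruct (Vp a Ha) as (h & Hh & Ph & E & K); destruct (Vp b Hb) as (h' & Hh' & Ph' & E' & K').
    rewrite E, E'; rewrite (dB HX OM (ss_dist S)) by assumption.
    destruct (stopping_time Ha) as (m & Hm & Am & _).
    (* the least index at which [r] enters either cut treats both radii symmetrically *)
    destruct (omega_least HX Hw (P := fun n => app r n ∈ a \/ app r n ∈ b) (n := m))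
      as (n & Hn & An & Mn); [pose proof r_fun; definability|exact Hm|now left|].
    assert (T : forall k, k ∈ w -> upto k n -> ~ stopped a k /\ ~ stopped b k).
    { intros k Hk Kn; split; intros (j & Hj & Aj);
        (assert (Hjn : j ∈ n) by
          (destruct Kn as [Kn| ->]; [exact (omega_mem_trans Hw Hn Hj Kn)|exact Hj]));
        apply (Mn j Hjn); auto. }
    assert (L : wle W (d M (pair h t0) (pair h' t0)) (app r n)).
    { rewrite <- (K n Hn) by (apply T; [exact Hn|now right]).
      apply (ss_agree S); try assumption; intros k Hk Kn; destruct (T k Hk Kn).
      rewrite K, K'; auto. }
    apply (completion_pos HX OM) in Ha; apply (completion_pos HX OM) in Hb.
    destruct Ha as [Ha _]; destruct Hb as [Hb _].
    apply (completion_wle_trans HX (down_le HX OM L)).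
    destruct An as [An|An].
    + apply (completion_wle_trans HX (down_le_cut HX OM Ha An)).
      now apply completion_wle_addl.
    + apply (completion_wle_trans HX (down_le_cut HX OM Hb An)).
      now apply completion_wle_addr.
  - intros e He; exists (down W e); split; [now apply down_pos|].
    intros a [y Hy] La; apply (func_dom HX Fp) in Hy; destruct Hy as [Ha _].
    destruct (Vp a Ha) as (h & Hh & Ph & E & K).
    destruct (stopping_time Ha) as (n & Hn & An & Tn).
    rewrite E, (ss_swap0 S Hh).
    apply (wle_trans OM) with (app r n).
    + rewrite <- (K n Hn) by (rewrite (Tn n Hn); intros T; apply T; now right).
      apply (ss_agree S); auto; apply (ss_pts S); eauto 8.
    + apply (completion_wle HX) in La; destruct La as (_ & _ & La).
      apply (in_down HX OM); auto.
Qed.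

End NewPoint.

(** Where [c] reaches [i], the initial sequence has dropped below its value at
    [i]. *)
Lemma sequence_of_cofinal_map (X : membership) (HX : ZFC X) (W : monoid_data X)
  (OM : ordered_monoid W) (w kappa s c : X) :
  is_func s kappa (wpos W) ->
  (forall i j : X, i ∈ kappa -> j ∈ kappa -> ord_le i j -> wle W (app s j) (app s i)) ->
  (forall x : X, x ∈ wpos W -> exists i, i ∈ kappa /\ wle W (app s i) x) ->
  cofinal_map c w kappa ->
  exists r, is_func r w (wpos W) /\
    forall x : X, x ∈ wpos W -> exists n, n ∈ w /\ wle W (app r n) x.
Proof.
  intros Fs Ms Cs [Fc Cc].
  assert (Us : forall x y y' : X, pair x y ∈ s -> pair x y' ∈ s -> y = y')
    by exact (fun x y y' => func_fun HX Fs).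
  assert (Uc : forall x y y' : X, pair x y ∈ c -> pair x y' ∈ c -> y = y')
    by exact (fun x y y' => func_fun HX Fc).
  destruct (@func_exists X HX w (wpos W) (fun n y => y = app s (app c n))) as (r & Fr & Er).
  - definability.
  - intros n Hn; eexists; split; [|reflexivity].
    exact (app_in HX Fs (app_in HX Fc Hn)).
  - congruence.
  - exists r; split; [exact Fr|]; intros x Hx; destruct (Cs x Hx) as (i & Hi & L).
    destruct (Cc i Hi) as (n & Hn & Ln); exists n; split; [exact Hn|].
    rewrite (Er n Hn); apply (wle_trans OM) with (app s i); [|exact L].
    apply Ms; auto; exact (app_in HX Fc Hn).
Qed.

Theorem theorem6p8 (U : membership) (HU : ZFC U) (V0 V1 : U -> Prop)
  (HV0 : model_of_set_theory V0) (HV1 : model_of_set_theory V1)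
  (H01 : forall x : U, V0 x -> V1 x)
  (W : monoid_data (subclass V0))
  (HW : is_distance_monoid W) (HWc : continuous W)
  (omega0 kappa : subclass V0)
  (Homega0 : is_omega omega0) (Hkappa : is_coinit W kappa)
  (Hlt : mem omega0 kappa)
  (omega1 : subclass V1)
  (Homega1 : is_omega omega1) (Hcof : is_cofinality (incl H01 kappa) omega1) :
  exists (M : space (subclass V0)) (f : subclass V0),
    is_dynamical_system W M f /\
    ~ has_fixed_point M f /\
    exists (W1 : monoid_data (subclass V1)) (M1 : space (subclass V1))
           (g : subclass V1),
      is_relativization H01 W M f W1 M1 g /\ has_fixed_point M1 g.
Proof.
  destruct HV0 as [T0 Z0]; destruct HV1 as [T1 Z1].
  assert (Ne : omega0 <> kappa) by (intros <-; exact (mem_irrefl Z0 Hlt)).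
  destruct (construction Z0 HW HWc Homega0 Hkappa Hlt Ne) as (M & f & N & S & Dyn & NF).
  exists M, f; split; [exact Dyn|]; split; [exact NF|].
  set (io := incl H01).
  assert (io_mem : forall x y : subclass V0, io x ∈ io y <-> x ∈ y)
    by (intros x y; reflexivity).
  (* transitivity of the smaller model *)
  assert (io_surj : forall (a : subclass V0) (y : subclass V1), y ∈ io a ->
    exists x : subclass V0, x ∈ a /\ y = io x).
  { intros a [y Vy] Hy; exists (exist _ y (T0 _ _ (proj2_sig a) Hy)); split; [exact Hy|].
    unfold io, incl; simpl; f_equal; apply proof_irrelevance. }
  pose proof (distance_monoid_ordered HW) as OM.
  pose proof (io_ordered_monoid Z0 Z1 io_mem io_surj OM) as OM1.
  pose proof (io_continuous Z0 Z1 io_mem io_surj OM (proj2 HWc)) as HC1.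
  pose proof (io_shift_system Z0 Z1 io_mem io_surj OM S) as S1.
  pose proof (io_omega Z0 Z1 io_mem io_surj Homega0) as Hw1.
  destruct Hcof as (_ & _ & (c & Hc) & _).
  rewrite (omega_unique Z1 Homega1 Hw1) in Hc.
  destruct Hkappa as [(s & _ & Fs & Ms & Cs) _].
  destruct (@sequence_of_cofinal_map _ Z1 _ OM1 (io omega0) (io kappa) (io s) c)
    as (r & Fr & Cr).
  - rewrite <- (io_wpos Z0 Z1 io_mem io_surj); exact (io_func Z0 Z1 io_mem io_surj Fs).
  - intros i j Hi Hj L; apply io_surj in Hi; destruct Hi as (i' & Hi & ->).
    apply io_surj in Hj; destruct Hj as (j' & Hj & ->).
    rewrite !(io_app Z0 Z1 io_mem io_surj Fs), (io_wle Z0 Z1 io_mem io_surj) by assumption.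
    apply Ms; try assumption; destruct L as [L|L]; [left; exact L|right].
    exact (io_inj Z0 io_mem L).
  - intros x Hx; rewrite <- (io_wpos Z0 Z1 io_mem io_surj) in Hx.
    apply io_surj in Hx; destruct Hx as (y & Hy & ->).
    destruct (Cs y Hy) as (i & Hi & L); exists (io i); split; [exact Hi|].
    rewrite (io_app Z0 Z1 io_mem io_surj Fs Hi); now apply io_wle.
  - exact Hc.
  - destruct (new_fixed_point Z1 OM1 HC1 S1 Hw1 Fr Cr) as (g & Hg & Fix).
    exists (completion (map_monoid io W)), (cc (map_monoid io W) (map_space io M)), g.
    split; [|exact Fix]; split; [reflexivity|]; split; [reflexivity|exact Hg].
Qed.
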